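(* Let $\chi\ge2$ be an integer and let $\mathcal{B}^{(\chi)}=(\mathcal{V},\mathcal{E})$ be the Bethe lattice of degree $\chi$, with a fixed root $r\in\mathcal{V}$. For $\xi\in\mathbb{N}$ let $\mathcal{B}^{(\chi)[\xi]}=(\mathcal{V}^{[\xi]},\mathcal{E}^{[\xi]})$ be the subtree induced by the vertices at graph distance at most $\xi$ from $r$, and let $d^{[\xi]}=|\mathcal{V}^{[\xi]}|$. Let $\boldsymbol{\lambda}=(\lambda_v)_{v\in\mathcal{V}}$ and $\boldsymbol{\alpha}=(\alpha_e)_{e\in\mathcal{E}}$ be admissible parameters with $\sup_{v\in\mathcal{V}}\lambda_v<\infty$ and $\sup_{e\in\mathcal{E}}\alpha_e<1$. For each $\xi\in\mathbb{N}$ let $\boldsymbol{N}^{[\xi]}\sim\mathrm{MPMRF}(\boldsymbol{\lambda},\boldsymbol{\alpha},\mathcal{B}^{(\chi)[\xi]})$ (with parameters restricted to $\mathcal{V}^{[\xi]}$ and $\mathcal{E}^{[\xi]}$), and let $X_v^{[\xi]}=\sum_{j=1}^{N_v^{[\xi]}}B_{v,j}$ for $v\in\mathcal{V}^{[\xi]}$, where for each $v$ the nonnegative variables $B_{v,1},B_{v,2},\dots$ are i.i.d. copies of $B_v$, the sequences for different $v$ are mutually independent and independent of $\boldsymbol{N}^{[\xi]}$, and $\sup_{v\in\mathcal{V}}\mathbb{E}[B_v^2]<\infty$. Let $S^{[\xi]}=\sum_{v\in\mathcal{V}^{[\xi]}}X_v^{[\xi]}$. For each $\xi$, consider a linear fair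 risk-sharing rule $$h^{\mathrm{lin}}_{v,d^{[\xi]}}(S^{[\xi]})=\mathbb{E}[X_v^{[\xi]}]+a_{v,d^{[\xi]}}\big(S^{[\xi]}-\mathbb{E}[S^{[\xi]}]\big),\qquad v\in\mathcal{V}^{[\xi]},$$ with real coefficients satisfying $\sum_{v\in\mathcal{V}^{[\xi]}}a_{v,d^{[\xi]}}=1$. Then for every $v\in\mathcal{V}$: if $a_{v,d^{[\xi]}}=\mathcal{O}(1/d^{[\xi]})$ as $\xi\to\infty$, then $$\lim_{\xi\to\infty}h^{\mathrm{lin}}_{v,d^{[\xi]}}(S^{[\xi]})=\mathbb{E}[X_v^{[\xi]}]\quad\text{in probability}$$ (note that $\mathbb{E}[X_v^{[\xi]}]=\lambda_v\mathbb{E}[B_v]$ does not depend on $\xi$).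
   Context: The Bethe lattice of degree $\chi$ is the infinite tree in which every vertex has exactly $\chi$ neighbors. Edges are undirected, so $\alpha_{(u,v)}=\alpha_{(v,u)}$. Parameters are admissible if $\lambda_v>0$ for all vertices $v$ and $0<\alpha_{(u,v)}\le\min(\sqrt{\lambda_u/\lambda_v},\sqrt{\lambda_v/\lambda_u})$ for every edge $(u,v)$. Binomial thinning: for an $\mathbb{N}$-valued $Y$ and $\theta\in[0,1]$, $\theta\circ Y:=\sum_{j=1}^{Y}I_j^{(\theta)}$ with $(I_j^{(\theta)})_{j\ge1}$ i.i.d. Bernoulli($\theta$), independent of $Y$. For a finite tree $\mathcal{T}$ with admissible parameters, $\boldsymbol{N}\sim\mathrm{MPMRF}(\boldsymbol{\lambda},\boldsymbol{\alpha},\mathcal{T})$ means: for a choice of root $r$ (the resulting law does not depend on the choice), with $\mathrm{pa}(v)$ the parent of $v$ in $\mathcal{T}$ rooted at $r$, $N_r=L_r$ and $N_v=\big(\alpha_{(\mathrm{pa}(v),v)}\sqrt{\lambda_v/\lambda_{\mathrm{pa}(v)}}\big)\circ N_{\mathrm{pa}(v)}+L_v$ for $v\ne r$, where the $L_v$ are independent, $L_r\sim\mathrm{Poisson}(\lambda_r)$, $L_v\sim\mathrm{Poisson}\big(\lambda_v(1-\alpha_{(\mathrm{pa}(v),v)}\sqrt{\lambda_{\mathrm{pa}(v)}/\lambda_v})\big)$ for $v\neq r$, and the Bernoulli sequences used in the thinnings are mutually independent and independent of the $L_v$. A Poisson distribution with parameter $0$ is the point mass at $0$; empty sums are $0$.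 For a fixed vertex $v$, quantities such as $X_v^{[\xi]}$ and $a_{v,d^{[\xi]}}$ are considered for all $\xi$ large enough that $v\in\mathcal{V}^{[\xi]}$. *)

(* Defs.v *)
From HB Require Import structures.
From mathcomp Require Import all_boot all_order all_algebra finmap.
From mathcomp Require Import all_classical all_reals all_analysis.

Set Implicit Arguments.
Unset Strict Implicit.
Unset Printing Implicit Defensive.

Import Order.TTheory GRing.Theory Num.Theory.
Import numFieldNormedType.Exports.

Local Open Scope classical_set_scope.
Local Open Scope ring_scope.

(** Graphs on a possibly infinite vertex type, given by their adjacency. *)
Section graphs.
Variables (V : choiceType) (E : rel V).

Definition walk (u v : V) (n : nat) : Prop :=
  exists p : seq V, [/\ path E u p, last u p = v & size p = n].

(* Meaningful when [u] and [v] are connected; the default value is 0. *)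
Definition graph_dist (u v : V) : nat :=
  xget 0%N [set n | walk u v n /\ forall m, walk u v m -> (n <= m)%N].

(* The cycles [p] of length at most 2 are the backtracking ones. *)
Definition is_tree : Prop :=
  [/\ symmetric E, irreflexive E,
      forall u v, exists n, walk u v n
    & forall p : seq V, ucycle E p -> (size p <= 2)%N].

Definition bethe_lattice (chi : nat) : Prop :=
  is_tree /\ forall v, ([set u | E v u] #= `I_chi)%card.

Definition ball_vertices (r : V) (n : nat) : set V :=
  [set v | (graph_dist r v <= n)%N].

Definition induced_edges (W : set V) : rel V :=
  [rel u v | [&& u \in W, v \in W & E u v]].

(* In a tree rooted at [rho], the parent of [v <> rho]; the default is [v]. *)
Definition parent (rho v : V) : V :=
  xget v [set u | E u v /\ graph_dist rho v = (graph_dist rho u).+1].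

End graphs.

Section independence.
Context d (T : measurableType d) (R : realType) (P : probability T R).

Definition mutually_independent (I : choiceType) (D : set I)
    (F : I -> set (set T)) : Prop :=
  forall (J : {fset I}) (A : I -> set T),
    (forall i, i \in J -> D i /\ F i (A i)) ->
    P (\bigcap_(i in [set` J]) A i) = (\prod_(i <- J) P (A i))%E.

Definition sigma_of d' (T' : measurableType d') (Y : T -> T') : set (set T) :=
  preimage_set_system setT Y measurable.

Definition sigma_of_family (I : Type) (D : set I) d' (T' : measurableType d')
    (Y : I -> T -> T') : set (set T) :=
  <<s \bigcup_(i in D) sigma_of (Y i) >>.

End independence.

Definition thinning (T : Type) (I : nat -> T -> bool) (Y : T -> nat) : T -> nat :=
  fun w => (\sum_(j < Y w) I j w)%N.

Definition compound_sum (T : Type) (R : realType) (Y : T -> nat)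
    (B : nat -> T -> R) : T -> R :=
  fun w => \sum_(j < Y w) B j w.

(* The second argument of [poisson_prob] is unused by the library definition;
   [poisson_prob 0] is the point mass at 0. *)
Definition has_poisson_law d (T : measurableType d) (R : realType)
    (P : probability T R) (rate : R) (Y : {RV P >-> nat}) : Prop :=
  forall A : set nat, distribution P Y A = poisson_prob rate 0%N A.

Definition has_bernoulli_law d (T : measurableType d) (R : realType)
    (P : probability T R) (p : R) (Y : {RV P >-> bool}) : Prop :=
  forall A : set bool, distribution P Y A = bernoulli_prob p A.

Definition same_law d1 (T1 : measurableType d1) d2 (T2 : measurableType d2)
    (R : realType) (P1 : probability T1 R) (P2 : probability T2 R)
    (Y1 : {RV P1 >-> R}) (Y2 : {RV P2 >-> R}) : Prop :=
  forall A : set R, measurable A -> distribution P1 Y1 A = distribution P2 Y2 A.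

(* The law of the vector [(N v)_(v in W)] on [nat^W], for [W] finite; an event
   is a set [A] of functions on [V], of which only the values on [W] count. *)
Definition vector_law (V : Type) (W : set V) d (T : measurableType d)
    (R : realType) (P : probability T R) (N : V -> T -> nat)
    (A : set (V -> nat)) : \bar R :=
  P [set w | exists2 k, A k & forall v, W v -> k v = N v w].

Definition admissible (V : choiceType) (E : rel V) (R : realType)
    (lambda : V -> R) (alpha : V -> V -> R) : Prop :=
  [/\ forall v, 0 < lambda v,
      forall u v, E u v -> alpha u v = alpha v u
    & forall u v, E u v ->
        0 < alpha u v <= Num.min (Num.sqrt (lambda u / lambda v))
                                 (Num.sqrt (lambda v / lambda u))].

Section mpmrf.
Variables (V : choiceType) (W : set V) (E : rel V) (R : realType).
Variables (lambda : V -> R) (alpha : V -> V -> R).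

(* The stochastic representation on the tree with vertex set [W] and adjacency
   [E], rooted at [rho]. *)
Definition mpmrf_construction (rho : V) d (T : measurableType d)
    (P : probability T R) (L : V -> {RV P >-> nat})
    (I : V -> nat -> {RV P >-> bool}) (N : V -> T -> nat) : Prop :=
  let pa := parent E rho in
  [/\ mutually_independent P
        [set i : V + V * nat | match i with
           | inl v => W v
           | inr vj => W vj.1 /\ vj.1 <> rho end]
        (fun i => match i with
           | inl v => sigma_of (L v)
           | inr vj => sigma_of (I vj.1 vj.2) end),
      has_poisson_law (lambda rho) (L rho),
      forall v, W v -> v <> rho ->
        has_poisson_law
          (lambda v * (1 - alpha (pa v) v * Num.sqrt (lambda (pa v) / lambda v)))
          (L v) /\
        forall j, has_bernoulli_law
          (alpha (pa v) v * Num.sqrt (lambda v / lambda (pa v))) (I v j),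
      N rho = L rho
    & forall v, W v -> v <> rho ->
        N v = (fun w => thinning (I v) (N (pa v)) w + L v w)%N].

(* Equality in law with the representation, which may live on another space;
   its law does not depend on the root [rho]. *)
Definition MPMRF d (T : measurableType d) (P : probability T R)
    (N : V -> {RV P >-> nat}) : Prop :=
  exists rho : V, W rho /\
  exists (d' : measure_display) (T' : measurableType d') (P' : probability T' R)
    (L : V -> {RV P' >-> nat}) (I : V -> nat -> {RV P' >-> bool})
    (N' : V -> T' -> nat),
    mpmrf_construction rho L I N' /\
    forall A : set (V -> nat), vector_law W P N A = vector_law W P' N' A.

End mpmrf.

(* Each [B v] is an i.i.d. sequence of copies of [B0 v]; [None] indexes the
   sigma-algebra of [N], [Some v] that of the sequence [B v]. *)
Definition claim_amounts (V : choiceType) (W : set V) (R : realType)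
    d0 (T0 : measurableType d0) (P0 : probability T0 R) (B0 : V -> {RV P0 >-> R})
    d (T : measurableType d) (P : probability T R)
    (N : V -> {RV P >-> nat}) (B : V -> nat -> {RV P >-> R}) : Prop :=
  [/\ forall v j, W v -> same_law (B v j) (B0 v),
      forall v, W v -> mutually_independent P setT (fun j => sigma_of (B v j))
    & mutually_independent P
        [set i : option V | if i is Some v then W v else True]
        (fun i => match i with
           | None => sigma_of_family W N
           | Some v => sigma_of_family setT (B v) end)].

Definition linear_rule (V : choiceType) (W : set V) (R : realType)
    d (T : measurableType d) (P : probability T R)
    (X : V -> T -> R) (a : V -> R) (v : V) : T -> R :=
  let S := fun w => \sum_(u \in W) X u w in
  fun w => fine ('E_P[X v])%E + a v * (S w - fine ('E_P[S])%E).

(* The underlying probability space may change along the sequence. *)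
Definition cvg_in_probability (R : realType) (d : nat -> measure_display)
    (T : forall n, measurableType (d n)) (P : forall n, probability (T n) R)
    (Y : forall n, T n -> R) (c : R) : Prop :=
  forall eps : R, 0 < eps ->
    P n [set w | eps <= `|Y n w - c|] @[n --> \oo] --> 0%E.

(* Main.v *)
(* The limit follows from Chebyshev's inequality once the variance of the total
   claim is o(d^2). Moving from a vertex to its parent multiplies the covariance
   of the counts, normalised by sqrt(lambda_u lambda_v), by the edge parameter
   alpha; so Cov(X_u, X_v) <= C abar^n for some walk of length n from u to v,
   with abar = sup alpha < 1. For each k, at most d (chi + 1)^k pairs of vertices
   are joined by a walk of length at most k, whence the variance is at most
   C (d (chi + 1)^k + d^2 abar^k). Since d tends to infinity (a finite ball that
   stopped growing would close a cycle, as chi >= 2), letting the radius, then k,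
   tend to infinity gives the result.

   All moments are computed as integrals of nonnegative functions, so that
   series and integrals commute without integrability conditions. *)
Require Import Defs.
From HB Require Import structures.
From mathcomp Require Import all_boot all_order all_algebra finmap.
From mathcomp Require Import all_classical all_reals all_analysis.
From mathcomp Require Import measurable_realfun ring lra.

Set Implicit Arguments.
Unset Strict Implicit.
Unset Printing Implicit Defensive.

Import Order.TTheory GRing.Theory Num.Theory.
Import numFieldNormedType.Exports.

Local Open Scope classical_set_scope.
Local Open Scope ring_scope.

(** * Independence of disjoint families of independent sigma-algebras *)

(** Two mismatches between the hypotheses and the moment computation shape the development. The
    counts are known only in law, through a construction that may live on another space and be
    rooted at any vertex of the ball; their mixed moments are therefore written as series of
    probabilities of events about the counts, and these are transferred. Independence is given for
    families of sigma-algebras indexed by innovations and thinning marks, whereas the recursion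
    needs a whole count, built from many of them, to be independent of those attached to one vertex;
    a grouping argument supplies this. Means are computed exactly, second moments only bounded
    above: an estimate E[S^2] <= (E S)^2 + Q is all that Chebyshev requires. In Q the constant C is
    [(beta * beta + m2) * lambda_max], where [m2] bounds E[B_v^2] and [beta] bounds E|B_v|; the
    final proof takes [beta = 1 + m2]. *)

Section independence.
Context d (T : measurableType d) (R : realType) (P : probability T R).

Definition independent_classes (F G : set (set T)) : Prop :=
  forall A B, F A -> G B -> P (A `&` B) = (P A * P B)%E.

Lemma independent_classesC F G :
  independent_classes F G -> independent_classes G F.
Proof. by move=> FG A B GA FB; rewrite setIC muleC; exact: FG. Qed.

(** Dynkin's argument: for one fixed [B] in [G], the events independent of [B] form a lambda-system
    that contains the pi-system [F]. Finiteness of [P B] serves for complements and for pulling it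
    out of the series. *)
Lemma independent_sigmal (F G : set (set T)) :
  F `<=` measurable -> G `<=` measurable -> setI_closed F ->
  independent_classes F G -> independent_classes <<s F>> G.
Proof.
move=> mF mG FI FG A B FA GB; have mB := mG _ GB.
pose H := [set A | measurable A /\ P (A `&` B) = (P A * P B)%E].
suff: H A by case.
have PBfin : P B \is a fin_num by exact: fin_num_measure.
apply: (lambda_system_subset FI _ _ _ FA) => //.
- apply/dynkin_lambda_system; split => /=.
  + by rewrite /H /= setTI probability_setT mul1e.
  + move=> C [mC PC]; split; first exact: measurableC.
    have PCfin : P C \is a fin_num by exact: fin_num_measure.
    rewrite probability_setC// muleBl// ?mul1e// -PC setIC -setDE measureD//.
      by rewrite setIC.
    by rewrite ltey_eq PBfin.
  + move=> C tC HC; split; first by apply: bigcup_measurable => k _; case: (HC k).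
    rewrite setI_bigcupl measure_bigcup//=; last 2 first.
      by move=> k _; apply: measurableI => //; case: (HC k).
      exact: trivIset_setIr.
    rewrite measure_bigcup//=; last by move=> k _; case: (HC k).
    rewrite muleC -(fineK PBfin) -nneseriesZl//.
    by apply: eq_eseriesr => k _; case: (HC k) => _ ->; rewrite fineK// muleC.
- by move=> C FC; split; [exact: mF|exact: FG].
Qed.

Lemma independent_sigma (F G : set (set T)) :
  F `<=` measurable -> G `<=` measurable -> setI_closed F -> setI_closed G ->
  independent_classes F G -> independent_classes <<s F>> <<s G>>.
Proof.
move=> mF mG FI GI FG; apply: independent_sigmal => //.
  by apply: smallest_sub => //; exact: sigma_algebra_measurable.
by apply/independent_classesC/independent_sigmal => //; exact/independent_classesC.
Qed.

Section coalition.
Context (I : choiceType) (D : set I) (F : I -> set (set T)).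
Hypothesis indepF : mutually_independent P D F.
Hypothesis FT : forall i, D i -> F i setT.
Hypothesis FI : forall i, D i -> setI_closed (F i).
Hypothesis mF : forall i, D i -> F i `<=` measurable.

(** A union of pi-systems is in general not closed under intersection. These sets are, they contain
    every [F i] with [i] in [K], and [mutually_independent] gives the product formula exactly for
    them. *)
Definition finite_intersections (K : set I) : set (set T) :=
  [set A | exists (J : {fset I}) (G : I -> set T),
     (forall i, i \in J -> K i /\ F i (G i)) /\ A = \bigcap_(i in [set` J]) G i].

Lemma setI_closed_finite_intersections K : K `<=` D ->
  setI_closed (finite_intersections K).
Proof.
move=> KD _ _ [J1 [G1 [KG1 ->]]] [J2 [G2 [KG2 ->]]].
(* At an index shared by both families the two events are intersected, which stays inside [F i]; a
   missing event is replaced by [setT]. *)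
exists (J1 `|` J2)%fset, (fun i => (if i \in J1 then G1 i else setT) `&`
  (if i \in J2 then G2 i else setT)); split.
  move=> i; rewrite inE => iJ.
  have Ki : K i by case/orP: iJ => [/KG1|/KG2] [].
  split=> //; have Di := KD _ Ki; apply: FI => //.
    by case: ifPn => [/KG1[]//|_]; exact: FT.
  by case: ifPn => [/KG2[]//|_]; exact: FT.
apply/seteqP; split => w /=.
  move=> [w1 w2] i /=; rewrite inE => iJ; split.
    by case: ifPn => // ?; exact: w1.
  by case: ifPn => // ?; exact: w2.
move=> wJ; split => i /= iJ.
  by have /wJ[] : i \in (J1 `|` J2)%fset by [rewrite inE iJ]; rewrite iJ.
by have /wJ[_] : i \in (J1 `|` J2)%fset by [rewrite inE iJ orbT]; rewrite iJ.
Qed.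

Lemma finite_intersections_sub K : K `<=` D ->
  finite_intersections K `<=` measurable.
Proof.
move=> KD _ [J [G [KG ->]]]; apply: fin_bigcap_measurable => [|i /= iJ].
  exact: finite_fset.
by have [Ki] := KG i iJ; apply: mF; exact: KD.
Qed.

(** Disjointness lets the two finite families be merged into a single one, so that all three
    probabilities become products over index sets. *)
Lemma independent_finite_intersections K1 K2 : K1 `<=` D -> K2 `<=` D ->
  K1 `&` K2 = set0 ->
  independent_classes (finite_intersections K1) (finite_intersections K2).
Proof.
move=> K1D K2D K12 _ _ [J1 [G1 [KG1 ->]]] [J2 [G2 [KG2 ->]]].
pose G i := if i \in J1 then G1 i else G2 i.
have J12 i : i \in J2 -> i \notin J1.
  move=> /KG2[K2i _]; apply/negP => /KG1[K1i _].
  by move/seteqP : K12 => [/(_ i) + _]; apply; split.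
have -> : \bigcap_(i in [set` J1]) G1 i `&` \bigcap_(i in [set` J2]) G2 i =
    \bigcap_(i in [set` (J1 `|` J2)%fset]) G i.
  apply/seteqP; split => w /=.
    move=> [w1 w2] i /=; rewrite inE /G; case: ifPn => [/w1//|_ /= /w2//].
  move=> wJ; split => i /= iJ.
    by have /wJ : i \in (J1 `|` J2)%fset by [rewrite inE iJ]; rewrite /G iJ.
  have /wJ : i \in (J1 `|` J2)%fset by rewrite inE iJ orbT.
  by rewrite /G (negbTE (J12 _ iJ)).
rewrite !indepF.
- rewrite (perm_big (J1 ++ J2)); last first.
    apply: uniq_perm => //; first by rewrite cat_uniq !fset_uniq /= andbT;
      apply/hasPn => i /J12.
    by move=> i; rewrite mem_cat inE.
  rewrite big_cat/=; congr (_ * _)%E.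
    by apply: eq_big_seq => i iJ; rewrite /G iJ.
  by apply: eq_big_seq => i iJ; rewrite /G (negbTE (J12 _ iJ)).
- by move=> i /KG2[/K2D].
- by move=> i /KG1[/K1D].
- move=> i; rewrite inE /G; case: ifPn => [/KG1[/K1D]//|_ /= /KG2[/K2D]//].
Qed.

(** The grouping lemma behind every later independence claim: the sources of one vertex against all
    others, counts against claim amounts, claims with different indices. *)
Lemma independent_coalition K1 K2 : K1 `<=` D -> K2 `<=` D ->
  K1 `&` K2 = set0 ->
  independent_classes <<s \bigcup_(i in K1) F i>> <<s \bigcup_(i in K2) F i>>.
Proof.
move=> K1D K2D K12.
have sub K : \bigcup_(i in K) F i `<=` finite_intersections K.
  move=> A [i Ki FA]; exists [fset i]%fset, (fun=> A); split.
    by move=> j; rewrite inE => /eqP ->.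
  by apply/seteqP; split=> [w Aw j //|w]; apply; rewrite /= inE.
have h := independent_sigma (finite_intersections_sub K1D)
  (finite_intersections_sub K2D) (setI_closed_finite_intersections K1D)
  (setI_closed_finite_intersections K2D)
  (independent_finite_intersections K1D K2D K12).
move=> A B AF BF; apply: h; [move: AF|move: BF].
  exact: (sub_sigma_algebra2 (@sub _)).
exact: (sub_sigma_algebra2 (@sub _)).
Qed.

End coalition.

End independence.

(** The generating family is an argument rather than a structure on [T], so that several
    sub-sigma-algebras of the same space can be used side by side. *)
Definition measurable_wrt (T : Type) (G : set (set T)) d' (T' : measurableType d')
    (f : T -> T') : Prop :=
  forall A, measurable A -> <<s G>> (f @^-1` A).

(** * Moments of compound sums *)

Section expectation_product.
Context d (T : measurableType d) (R : realType) (P : probability T R).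
Local Open Scope ereal_scope.

Lemma measurable_wrtT (G : set (set T)) d' (T' : measurableType d') (f : T -> T') :
  G `<=` measurable -> measurable_wrt G f -> measurable_fun setT f.
Proof.
move=> mG mf _ A mA; rewrite setTI; apply: (_ : <<s G>> `<=` measurable).
  by apply: smallest_sub => //; exact: sigma_algebra_measurable.
exact: mf.
Qed.

(** By independence the law of the pair agrees with the product of the laws on rectangles, hence
    everywhere; Tonelli then splits the integral. *)
Lemma independent_integral_compM d1 d2 (T1 : measurableType d1)
    (T2 : measurableType d2) (X : {RV P >-> T1}) (Y : {RV P >-> T2})
    (f : T1 -> R) (g : T2 -> R) :
  (forall A B, measurable A -> measurable B ->
     P (X @^-1` A `&` Y @^-1` B) = P (X @^-1` A) * P (Y @^-1` B)) ->
  measurable_fun setT f -> measurable_fun setT g ->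
  (forall x, 0 <= f x)%R -> (forall y, 0 <= g y)%R ->
  \int[P]_w (f (X w) * g (Y w))%:E =
    \int[P]_w (f (X w))%:E * \int[P]_w (g (Y w))%:E.
Proof.
move=> XY mf mg f0 g0.
have mh : measurable_fun setT (fun w => (X w, Y w)) by exact: measurable_fun_pair.
pose h_mixin := isMeasurableFun.Build _ _ T (T1 * T2)%type _ mh.
pose Z : {mfun T >-> (T1 * T2)%type} := HB.pack (fun w => (X w, Y w)) h_mixin.
pose k (z : T1 * T2) : \bar R := (f z.1 * g z.2)%:E.
have k0 z : 0 <= k z by rewrite lee_fin mulr_ge0.
have mk : measurable_fun [set: T1 * T2] k.
  by apply/measurable_EFinP/measurable_funM; exact: measurableT_comp.
transitivity (\int[distribution P Z]_z k z).
  by rewrite ge0_integral_distribution.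
transitivity (\int[distribution P X \x distribution P Y]_z k z).
  apply: eq_measure_integral => A mA _; exact/esym/product_measure_unique.
rewrite (fubini_tonelli1 k)//= /fubini_F/=.
have mf' : measurable_fun setT (fun x => (f x)%:E) by exact/measurable_EFinP.
have mg' : measurable_fun setT (fun x => (g x)%:E) by exact/measurable_EFinP.
have f0' x : 0 <= (f x)%:E by rewrite lee_fin.
have g0' y : 0 <= (g y)%:E by rewrite lee_fin.
under eq_integral => x _.
  under eq_integral do rewrite /k EFinM /=.
  rewrite ge0_integralZl_EFin//; over.
rewrite ge0_integralZr//; last exact: integral_ge0.
by rewrite !ge0_integral_distribution.
Qed.

Lemma independent_integralM (G1 G2 : set (set T)) (f g : T -> R) :
  G1 `<=` measurable -> G2 `<=` measurable ->
  independent_classes P <<s G1>> <<s G2>> ->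
  measurable_wrt G1 f -> measurable_wrt G2 g ->
  (forall w, 0 <= f w)%R -> (forall w, 0 <= g w)%R ->
  \int[P]_w (f w * g w)%:E = \int[P]_w (f w)%:E * \int[P]_w (g w)%:E.
Proof.
move=> mG1 mG2 G12 mf mg f0 g0.
have mf' := measurable_wrtT mG1 mf; have mg' := measurable_wrtT mG2 mg.
pose f_mixin := isMeasurableFun.Build _ _ _ _ _ mf'.
pose X : {mfun T >-> R} := HB.pack f f_mixin.
pose g_mixin := isMeasurableFun.Build _ _ _ _ _ mg'.
pose Y : {mfun T >-> R} := HB.pack g g_mixin.
(* The lemma above wants functions that are nonnegative on all of [R]; the absolute value is one,
   and it changes nothing on the values of [f] and [g]. *)
have fE w : f w = `|X w|%R by rewrite ger0_norm.
have gE w : g w = `|Y w|%R by rewrite ger0_norm.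
under eq_integral do rewrite fE gE.
under [X in _ = X * _]eq_integral do rewrite fE.
under [X in _ = _ * X]eq_integral do rewrite gE.
apply: (@independent_integral_compM _ _ _ _ X Y (fun x => `|x|%R)
  (fun x => `|x|%R)) => //.
by move=> A B mA mB; apply: G12; [exact: mf|exact: mg].
Qed.

End expectation_product.

Lemma integral_probability_cst d (T : measurableType d) (R : realType)
    (P : probability T R) (c : R) : (\int[P]_w c%:E = c%:E)%E.
Proof.
transitivity (\int[P]_(w in setT) cst c%:E w)%E; first exact: eq_integral.
by rewrite integral_cst// -[RHS]mule1; congr (_ * _)%E; exact: probability_setT.
Qed.

Section compound_moments.
Context d (T : measurableType d) (R : realType) (P : probability T R).
Local Open Scope ereal_scope.

(** Turns a random number of terms into indicator weights: a compound sum becomes a full series,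
    which commutes with the integral. *)
Lemma sum_nneseries (n : nat) (b : nat -> R) : (forall j, 0 <= b j)%R ->
  (\sum_(j < n) b j)%:E = \sum_(0 <= j <oo) ((j < n)%N%:R * b j)%:E.
Proof.
move=> b0; rewrite (nneseries_split 0%N n) => [|k _]; last first.
  by rewrite lee_fin mulr_ge0.
rewrite add0n [X in _ + X]eseries0 => [|k nk _]; last first.
  by rewrite ltnNge nk mul0r.
rewrite adde0 big_mkord sumEFin; congr EFin.
by apply: eq_bigr => j _; rewrite ltn_ord mul1r.
Qed.

Variables (N M : T -> nat) (B C : nat -> T -> R).
Hypotheses (mN : measurable_fun setT N) (mM : measurable_fun setT M).
Hypotheses (mB : forall j, measurable_fun setT (B j))
  (mC : forall j, measurable_fun setT (C j)).
Hypotheses (B0 : forall j w, (0 <= B j w)%R) (C0 : forall j w, (0 <= C j w)%R).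

Lemma measurable_ltn_indicator (K : T -> nat) j : measurable_fun setT K ->
  measurable_fun setT (fun w => (j < K w)%N%:R : R).
Proof. by move=> mK; exact: (measurableT_comp (f := fun n => (j < n)%N%:R : R)). Qed.

Lemma integral_compound_sumM :
  \int[P]_w (compound_sum N B w * compound_sum M C w)%:E =
  \sum_(0 <= j <oo) \sum_(0 <= k <oo)
    \int[P]_w ((j < N w)%N%:R * (k < M w)%N%:R * (B j w * C k w))%:E.
Proof.
have m0 j k : measurable_fun setT
   (fun w => ((j < N w)%N%:R * (k < M w)%N%:R * (B j w * C k w))%:E).
  apply/measurable_EFinP; apply: measurable_funM; last exact: measurable_funM.
  by apply: measurable_funM; exact: measurable_ltn_indicator.
have p0 j k w : 0 <= ((j < N w)%N%:R * (k < M w)%N%:R * (B j w * C k w))%:E.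
  by rewrite lee_fin !mulr_ge0.
transitivity (\int[P]_w \sum_(0 <= j <oo) \sum_(0 <= k <oo)
    ((j < N w)%N%:R * (k < M w)%N%:R * (B j w * C k w))%:E); last first.
  rewrite integral_nneseries//=.
  - by apply: eq_eseriesr => j _; rewrite integral_nneseries.
  - by move=> j; apply: ge0_emeasurable_sum.
  - by move=> j w _; apply: nneseries_ge0.
apply: eq_integral => w _; rewrite /compound_sum EFinM.
rewrite (sum_nneseries (N w) (b := B ^~ w))// muleC.
rewrite -nneseriesZl; last by move=> j _; rewrite lee_fin mulr_ge0.
apply: eq_eseriesr => j _.
rewrite muleC (sum_nneseries (M w) (b := C ^~ w))// -nneseriesZl; last first.
  by move=> k _; rewrite lee_fin mulr_ge0.
by apply: eq_eseriesr => k _; rewrite -EFinM mulrACA.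
Qed.

End compound_moments.

Section compound_moments2.
Context d (T : measurableType d) (R : realType) (P : probability T R).
Local Open Scope ereal_scope.
Variables (N M : T -> nat) (B C : nat -> T -> R).
Hypotheses (mN : measurable_fun setT N) (mM : measurable_fun setT M).
Hypotheses (mB : forall j, measurable_fun setT (B j))
  (mC : forall j, measurable_fun setT (C j)).
Hypotheses (B0 : forall j w, (0 <= B j w)%R) (C0 : forall j w, (0 <= C j w)%R).

Lemma compound_sum1 (K : T -> nat) w :
  compound_sum K (fun _ _ => 1%R : R) w = (K w)%:R.
Proof. by rewrite /compound_sum sumr_const card_ord. Qed.

Lemma integral_natrM : \int[P]_w ((N w)%:R * (M w)%:R)%:E =
  \sum_(0 <= j <oo) \sum_(0 <= k <oo)
    \int[P]_w ((j < N w)%N%:R * (k < M w)%N%:R : R)%:E.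
Proof.
have m1 : forall j : nat, measurable_fun setT (fun _ : T => 1%R : R).
  by move=> _; exact: measurable_cst.
have p1 : forall (j : nat) (w : T), (0 <= 1 :> R)%R by move=> _ _; exact: ler01.
have := integral_compound_sumM P mN mM m1 m1 p1 p1.
under eq_integral do rewrite !compound_sum1.
move=> ->; apply: eq_eseriesr => j _; apply: eq_eseriesr => k _.
by apply: eq_integral => w _; rewrite !mulr1.
Qed.

(** [c] is the mean of one product [B j * C k], split off from the indicators by independence: the
    thinning probability in one use, a mean claim or a product of two in others. *)
Lemma integral_compound_sumM_factor (c : R) :
  (forall j k, \int[P]_w ((j < N w)%N%:R * (k < M w)%N%:R * (B j w * C k w))%:E =
     c%:E * \int[P]_w ((j < N w)%N%:R * (k < M w)%N%:R)%:E) ->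
  \int[P]_w (compound_sum N B w * compound_sum M C w)%:E =
  c%:E * \int[P]_w ((N w)%:R * (M w)%:R)%:E.
Proof.
move=> BC; rewrite integral_compound_sumM// integral_natrM.
have p0 j k : 0 <= \int[P]_w ((j < N w)%N%:R * (k < M w)%N%:R : R)%:E.
  by apply: integral_ge0 => w _; rewrite lee_fin mulr_ge0.
rewrite -nneseriesZl; last by move=> j _; exact: nneseries_ge0.
by apply: eq_eseriesr => j _; rewrite -nneseriesZl//; apply: eq_eseriesr.
Qed.

End compound_moments2.

Section compound_second_moment.
Local Open Scope ereal_scope.

(** Off the diagonal the terms have mean [c]; on it they are squares, whose larger mean is paid for
    by [e]. The diagonal indicators add up to [N] itself, hence the linear term. *)
Lemma le_integral_compound_sum_sqr d (T : measurableType d) (R : realType)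
    (P : probability T R) (N : T -> nat) (B : nat -> T -> R) (c e : R) :
  measurable_fun setT N -> (forall j, measurable_fun setT (B j)) ->
  (forall j w, 0 <= B j w)%R -> (0 <= c)%R -> (0 <= e)%R ->
  (forall j k, \int[P]_w ((j < N w)%N%:R * (k < N w)%N%:R * (B j w * B k w))%:E <=
     (c + (k == j)%:R * e)%:E * \int[P]_w ((j < N w)%N%:R * (k < N w)%N%:R)%:E) ->
  \int[P]_w (compound_sum N B w * compound_sum N B w)%:E <=
  c%:E * \int[P]_w ((N w)%:R * (N w)%:R)%:E + e%:E * \int[P]_w (N w)%:R%:E.
Proof.
move=> mN mB B0 c0 e0 BB; rewrite integral_compound_sumM// integral_natrM//.
pose p j k := \int[P]_w ((j < N w)%N%:R * (k < N w)%N%:R : R)%:E.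
have p0 j k : 0 <= p j k.
  by apply: integral_ge0 => w _; rewrite lee_fin mulr_ge0.
have -> : \int[P]_w (N w)%:R%:E = \sum_(0 <= j <oo) p j j.
  have mp j : measurable_fun setT
      (fun w => ((j < N w)%N%:R * (j < N w)%N%:R : R)%:E).
    by apply/measurable_EFinP/measurable_funM; exact: measurable_ltn_indicator.
  rewrite -(integral_nneseries _ _ mp)//=.
  apply: eq_integral => w _; rewrite -compound_sum1 /compound_sum.
  rewrite (sum_nneseries (N w) (b := fun=> 1%R))//.
  by apply: eq_eseriesr => j _; rewrite mulr1 -natrM mulnb andbb.
rewrite -nneseriesZl; last by move=> j _; apply: nneseries_ge0 => *; exact: p0.
rewrite -[X in _ <= _ + X]nneseriesZl//.
rewrite -nneseriesD//; last 2 first.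
- by move=> j _ _; rewrite mule_ge0//; apply: nneseries_ge0 => *; exact: p0.
- by move=> j _ _; rewrite mule_ge0.
apply: lee_nneseries => [j _ _|j _].
  apply: nneseries_ge0 => k _ _; apply: integral_ge0 => w _.
  by rewrite lee_fin !mulr_ge0.
(* The diagonal is spread out as a series in [k], so that the two sides can be compared term by
   term. *)
have -> : p j j = \sum_(0 <= k <oo) ((k == j)%:R%:E * p j k).
  rewrite (nneseriesD1 (n := j))//=; last by move=> k _; rewrite mule_ge0.
  rewrite eqxx mul1e eseries0 ?adde0// => k _ /negbTE ->.
  by rewrite mul0e.
rewrite -nneseriesZl; last by move=> k _; exact: p0.
rewrite -nneseriesZl; last by move=> k _; rewrite mule_ge0.
rewrite -nneseriesD//; last 2 first.
- by move=> k _ _; rewrite mule_ge0//; exact: p0.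
- by move=> k _ _; rewrite mule_ge0// mule_ge0.
apply: lee_nneseries => [k _ _|k _].
  by apply: integral_ge0 => w _; rewrite lee_fin !mulr_ge0.
apply: (le_trans (BB j k)); rewrite muleA -EFinM (mulrC e) EFinD ge0_muleDl//.
by rewrite lee_fin mulr_ge0.
Qed.

End compound_second_moment.

(** * Balls in the Bethe lattice *)

Section walks.
Context (V : choiceType) (E : rel V).

Lemma walk0 u : walk E u u 0.
Proof. by exists [::]. Qed.

Lemma walk0_eq u v : walk E u v 0 -> v = u.
Proof. by case=> p [_ <- /size0nil ->]. Qed.

Lemma walk_rcons u v w n : walk E u v n -> E v w -> walk E u w n.+1.
Proof.
move=> [p [Ep lp sp]] Evw; exists (rcons p w).
by rewrite rcons_path Ep lp last_rcons size_rcons sp.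
Qed.

Lemma walk_rconsP u w n : walk E u w n.+1 -> exists2 v, walk E u v n & E v w.
Proof.
case=> p; case/lastP: p => [[]//|p x].
rewrite rcons_path last_rcons size_rcons => -[/andP[Ep Ex] <- [sp]].
by exists (last u p) => //; exists p.
Qed.

Lemma walk_cat u v w m n : walk E u v m -> walk E v w n -> walk E u w (m + n).
Proof.
move=> [p [Ep lp sp]] [q [Eq lq sq]]; exists (p ++ q).
by rewrite cat_path Ep lp Eq last_cat lp lq size_cat sp sq.
Qed.

Lemma walk_sym u v n : symmetric E -> walk E u v n -> walk E v u n.
Proof.
move=> symE [p [Ep lp sp]]; exists (rev (belast u p)); split.
- by rewrite -lp rev_path; under eq_path do rewrite symE.
- by case: p Ep lp sp => [|x p] //= _ _ _; rewrite rev_cons last_rcons.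
- by rewrite size_rev size_belast.
Qed.

Lemma graph_distP u v n : walk E u v n ->
  walk E u v (graph_dist E u v) /\ (graph_dist E u v <= n)%N.
Proof.
move=> uvn; rewrite /graph_dist.
have [m [wm mmin]] : exists m, walk E u v m /\
    forall k, walk E u v k -> (m <= k)%N.
  have ex : exists m, `[<walk E u v m>] by exists n; apply/asboolP.
  exists (ex_minn ex); case: ex_minnP => m /asboolP wm mmin; split=> // k wk.
  by apply: mmin; apply/asboolP.
have := @xgetPex _ 0%N [set m | walk E u v m /\
    forall k, walk E u v k -> (m <= k)%N] (ex_intro _ m (conj wm mmin)).
by move=> [w0 w1]; split=> //; exact: w1.
Qed.

Lemma graph_dist_le u v n : walk E u v n -> (graph_dist E u v <= n)%N.
Proof. by case/graph_distP. Qed.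

Lemma graph_distxx u : graph_dist E u u = 0%N.
Proof. by apply/eqP; rewrite -leqn0; exact/graph_dist_le/walk0. Qed.

Lemma graph_dist_pred u v n : walk E u v n -> v <> u ->
  exists w, [/\ E w v, walk E u w (graph_dist E u w) &
    graph_dist E u v = (graph_dist E u w).+1].
Proof.
move=> /graph_distP[]; move dE: (graph_dist E u v) => [|m] wm _ vu.
  by have := walk0_eq wm.
have [w wuw Ewv] := walk_rconsP wm; exists w; split=> //.
  by have [] := graph_distP wuw.
apply/eqP; rewrite eqSS eqn_leq graph_dist_le// andbT -ltnS -dE.
by apply: graph_dist_le; apply: walk_rcons Ewv; have [] := graph_distP wuw.
Qed.

Lemma parentP rho v n : walk E rho v n -> v <> rho ->
  E (parent E rho v) v /\
  graph_dist E rho v = (graph_dist E rho (parent E rho v)).+1.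
Proof.
move=> wn vrho; have [w [Ewv _ dvw]] := graph_dist_pred wn vrho.
by apply: (@xgetPex _ v [set u | E u v /\ _ = (_ u).+1]); exists w.
Qed.

End walks.

Section locally_finite.
Context (V : choiceType) (E : rel V) (nbrs : V -> seq V) (chi : nat).
Hypothesis nbrsP : forall u v, E u v = (v \in nbrs u).
Hypothesis size_nbrs : forall u, size (nbrs u) = chi.

(** Repetitions are kept: each round multiplies the length by exactly [chi.+1], and the length still
    bounds the number of distinct vertices reached. *)
Definition reach (n : nat) (u : V) : seq V :=
  iter n (fun s => s ++ flatten (map nbrs s)) [:: u].

Lemma size_reach n u : size (reach n u) = (chi.+1 ^ n)%N.
Proof.
elim: n => //= n IH; rewrite size_cat size_flatten /shape -map_comp.
have -> : map (size \o nbrs) (reach n u) = nseq (size (reach n u)) chi.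
  by elim: (reach n u) => //= x s ->; rewrite size_nbrs.
by rewrite sumn_nseq IH expnS mulSn mulnC.
Qed.

Lemma walk_reach n k u v : walk E u v k -> (k <= n)%N -> v \in reach n u.
Proof.
elim: n k v => [|n IH] [|k] v w kn //.
- by rewrite (walk0_eq w) inE.
- by rewrite /= mem_cat (IH 0%N).
- have [x wx Exv] := walk_rconsP w.
  rewrite /= mem_cat; apply/orP; right; apply/flattenP; exists (nbrs x).
    by apply: map_f; exact: (IH k).
  by rewrite -nbrsP.
Qed.

End locally_finite.

Section bethe.
Context (V : choiceType) (E : rel V) (chi : nat) (r : V).
Hypothesis bethe : bethe_lattice E chi.

Let symE : symmetric E. Proof. by case: bethe => -[]. Qed.
Let irrE : irreflexive E. Proof. by case: bethe => -[]. Qed.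
Let connE u v : exists n, walk E u v n. Proof. by case: bethe => -[]. Qed.
Let walk_dist u v : walk E u v (graph_dist E u v).
Proof. by have [n /graph_distP[]] := connE u v. Qed.

Lemma bethe_nbrs : exists nbrs : V -> seq V,
  [/\ forall u v, E u v = (v \in nbrs u), forall u, size (nbrs u) = chi &
      forall u, uniq (nbrs u)].
Proof.
have card u : ([set v | E u v] #= `I_chi)%card by case: bethe.
have fin u : finite_set [set v | E u v].
  by apply/finite_setP; exists chi.
exists (fun u => fset_set [set v | E u v]); split.
- move=> u v; rewrite in_fset_set//; apply/idP/idP => [uv|]; first exact: mem_set.
  by rewrite inE.
- by move=> u; exact: card_fset_set.
- by move=> u; exact: fset_uniq.
Qed.

Lemma finite_ball_vertices n : finite_set (ball_vertices E r n).
Proof.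
have [nbrs [nbrsP sz _]] := bethe_nbrs.
apply: (sub_finite_set _ (finite_seq (reach nbrs n r))) => v /= vn.
exact: (walk_reach nbrsP (walk_dist r v)).
Qed.

(** A shortest walk to [u] has at most [n] steps and cannot visit [v] before step [n]; so [v] could
    only be its endpoint [u]. *)
Lemma avoiding_path n v u : graph_dist E r v = n -> (graph_dist E r u <= n)%N ->
  u <> v -> exists2 p, path E r p /\ last r p = u & v \notin r :: p.
Proof.
move=> vn un uv; have [p [Ep lp sp]] := walk_dist r u; exists p => //.
apply/negP => vp; have := vp; rewrite -index_mem /= => vi.
have [i ip iv] : exists2 i, (i <= size p)%N & last r (take i p) = v.
  move: vp; rewrite inE => /predU1P[->|vp]; first by exists 0%N; rewrite ?take0.
  exists (index v p).+1; first by rewrite index_mem.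
  by rewrite (last_nth v) size_takel ?index_mem//= nth_take// nth_index.
have wv : walk E r v i.
  exists (take i p); split=> //; last by rewrite size_takel.
  by move: Ep; rewrite -{1}(cat_take_drop i p) cat_path => /andP[].
have := graph_dist_le wv; rewrite vn => ni.
have ipE : i = size p by apply/eqP; rewrite eqn_leq ip sp (leq_trans un).
by apply: uv; rewrite -iv ipE take_size lp.
Qed.

(* If both of two neighbours of [v] were as close to [r] as [v], their shortest
   walks to [r] would avoid [v] and close a cycle through [v]. *)
Lemma exists_graph_dist n : (2 <= chi)%N -> exists v, graph_dist E r v = n.
Proof.
move=> chi2; elim: n => [|n [v vn]]; first by exists r; exact: graph_distxx.
have [nbrs [nbrsP sz un]] := bethe_nbrs.
have [[u Evu un1]|no] := pselect (exists2 u, E v u & (n < graph_dist E r u)%N).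
  exists u; apply/eqP; rewrite eqn_leq un1 andbT -vn.
  by apply: graph_dist_le; exact: (walk_rcons (walk_dist r v) Evu).
have near u : E v u -> (graph_dist E r u <= n)%N /\ u <> v.
  move=> Evu; split; last by move=> uv; move: Evu; rewrite uv irrE.
  by rewrite leqNgt; apply/negP => ?; apply: no; exists u.
move: (sz v) (un v); case nE: (nbrs v) => [|u1 [|u2 s]] /= szv;
  [by move: chi2; rewrite -szv..|].
rewrite inE negb_or => /andP[/andP[u12 _] _].
have Eu1 : E v u1 by rewrite nbrsP nE inE eqxx.
have Eu2 : E v u2 by rewrite nbrsP nE !inE eqxx orbT.
have [[d1 n1] [d2 n2]] := (near _ Eu1, near _ Eu2).
have [p1 [Ep1 lp1] vp1] := avoiding_path vn d1 n1.
have [p2 [Ep2 lp2] vp2] := avoiding_path vn d2 n2.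
(* From [u1] back to [r], then out to [u2]. This may revisit vertices, so it is shortened to a
   simple path before [v] closes the cycle; since [u1] and [u2] differ, the cycle has at least three
   vertices. *)
pose q := rev (belast r p1) ++ p2.
have Eq : path E u1 q.
  rewrite /q -lp1 cat_path rev_path.
  under eq_path do rewrite symE.
  rewrite Ep1 /=; case: (p1) => [|x p] //=.
  by rewrite rev_cons last_rcons.
have lq : last u1 q = u2.
  rewrite /q last_cat -lp2 -lp1; case: (p1) => [|x p] //=.
  by rewrite rev_cons last_rcons.
have vq : v \notin u1 :: q.
  have sub : {subset u1 :: q <= (r :: p1) ++ (r :: p2)}.
    move=> x; rewrite inE mem_cat mem_rev [in X in _ -> X]mem_cat.
    move=> /orP[/eqP ->|/orP[/mem_belast ->//|xp2]].
      by rewrite -lp1 mem_last.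
    by rewrite [x \in r :: p2]inE xp2 !orbT.
  by apply/negP => /sub; rewrite mem_cat (negbTE vp1) (negbTE vp2).
case/shortenP: Eq lq vq => q' Eq' uq' subq lq' vq.
have sz' : (1 < size (u1 :: q'))%N.
  case: q' lq' {Eq' uq' subq} => //= lq'; by rewrite lq' eqxx in u12.
have /(_ (v :: u1 :: q')) : forall p : seq V, ucycle E p -> (size p <= 2)%N.
  by case: bethe => -[].
suff : ucycle E (v :: u1 :: q').
  by move=> h /(_ h) /=; rewrite ltnNge in sz' *; move/negP: sz'.
rewrite /ucycle /= rcons_path Eu1 Eq' lq' symE Eu2 /=.
move: uq' => /= ->; rewrite andbT; apply: contra vq.
by rewrite !inE => /orP[->//|/subq ->]; rewrite orbT.
Qed.

(** One vertex at each distance from 0 to [n] already gives [n.+1] distinct ones. This linear bound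
    also covers [chi = 2], where the lattice is a line. *)
Lemma card_ball_vertices n : (2 <= chi)%N ->
  (n < #|` fset_set (ball_vertices E r n)|)%N.
Proof.
move=> chi2; have [f fP] := choice (fun n => exists_graph_dist n chi2).
have finB := finite_ball_vertices n.
have -> : n.+1 = size (map f (iota 0 n.+1)) by rewrite size_map size_iota.
apply: uniq_leq_size.
  rewrite map_inj_uniq ?iota_uniq// => i j fij.
  by rewrite -(fP i) -(fP j) fij.
move=> v /mapP[i]; rewrite mem_iota add0n => /andP[_ ni] ->.
by rewrite in_fset_set// inE /ball_vertices /= fP -ltnS.
Qed.

(** A shortest walk from [r] never leaves the ball. Connectedness of the induced subgraph is what
    makes parents meaningful there for any choice of the root. *)
Lemma walk_induced n v : ball_vertices E r n v ->
  exists k, walk (induced_edges E (ball_vertices E r n)) r v k.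
Proof.
move dv: (graph_dist E r v) => k; elim: k v dv => [|k IH] v dv vn.
  by exists 0%N; have := walk_dist r v; rewrite dv => /walk0_eq ->; exact: walk0.
have vr : v <> r by move=> vr; move: dv; rewrite vr graph_distxx.
have [w [Ewv _ dvw]] := graph_dist_pred (walk_dist r v) vr.
have dw : graph_dist E r w = k by move: dvw; rewrite dv => -[].
have wn : ball_vertices E r n w.
  by move: vn; rewrite /ball_vertices /= dw dv; exact: ltnW.
have [m wm] := IH w dw wn; exists m.+1; apply: walk_rcons wm _.
by rewrite /induced_edges /= Ewv !mem_set.
Qed.

Lemma walk_induced2 n u v : ball_vertices E r n u -> ball_vertices E r n v ->
  exists k, walk (induced_edges E (ball_vertices E r n)) u v k.
Proof.
move=> /walk_induced[k wk] /walk_induced[m wm]; exists (k + m)%N.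
apply: walk_cat wm; apply: walk_sym wk => x y.
by rewrite /induced_edges /= symE andbCA.
Qed.

End bethe.

(** * Moments of Poisson and Bernoulli variables *)

Section discrete_moments.
Context d (T : measurableType d) (R : realType) (P : probability T R).
Local Open Scope ereal_scope.

Lemma nneseries_shift (u : nat -> \bar R) : (forall k, 0 <= u k) -> u 0%N = 0 ->
  \sum_(0 <= k <oo) u k = \sum_(0 <= k <oo) u k.+1.
Proof.
move=> u0 u00; rewrite nneseries_recl// u00 add0e.
rewrite -(nneseries_addn 1 u0)//; apply: eq_eseriesr => k _.
by rewrite addn1.
Qed.

Lemma integral_nat_RV (Y : {RV P >-> nat}) (f : nat -> R) :
  (forall k, 0 <= f k)%R ->
  \int[P]_w (f (Y w))%:E =
    \sum_(0 <= k <oo) ((f k)%:E * distribution P Y [set k]).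
Proof.
move=> f0.
have mY k : measurable (Y @^-1` [set k]) by exact: measurable_sfunP.
have mI k : measurable_fun setT (fun w => (f k * \1_(Y @^-1` [set k]) w)%:E).
  by apply/measurable_EFinP/measurable_funM.
have I0 k w : 0 <= (f k * \1_(Y @^-1` [set k]) w)%:E.
  by rewrite lee_fin mulr_ge0.
transitivity (\int[P]_w \sum_(0 <= k <oo) (f k * \1_(Y @^-1` [set k]) w)%:E).
  apply: eq_integral => w _; rewrite (nneseriesD1 (n := Y w))//.
  rewrite indicE mem_set// mulr1 eseries0 ?adde0// => k _ /= kY.
  by rewrite indicE memNset ?mulr0//= => Yk; rewrite Yk eqxx in kY.
rewrite (integral_nneseries _ _ mI)//; apply: eq_eseriesr => k _.
under eq_integral do rewrite EFinM.
rewrite ge0_integralZl_EFin//.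
- by congr (_ * _); rewrite (integral_indic _ measurableT (mY k)) setIT.
- exact/measurable_EFinP.
Qed.

Section poisson.
Variables (rate : R) (Y : {RV P >-> nat}).
Hypotheses (rate0 : (0 <= rate)%R) (lawY : has_poisson_law rate Y).

Lemma poisson_pmf_recl k : (0 < rate)%R ->
  (k.+1%:R * poisson_pmf rate k.+1 = rate * poisson_pmf rate k)%R.
Proof.
move=> r0; rewrite /poisson_pmf r0 exprS factS natrM invfM.
have k0 : k.+1%:R != 0%R :> R by rewrite pnatr_eq0.
have f0 : k`!%:R != 0%R :> R by rewrite pnatr_eq0 -lt0n fact_gt0.
by field; rewrite f0 addrC natr1.
Qed.

(** The case split follows [poisson_prob]. Rate 0 does occur: an innovation vanishes when [alpha]
    equals the square root of [lambda v / lambda (pa v)], its largest admissible value if [v] has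
    the smaller parameter. *)
Lemma integral_poisson_law (f : nat -> R) : (forall k, 0 <= f k)%R ->
  \int[P]_w (f (Y w))%:E = if (0 < rate)%R then
    \sum_(0 <= k <oo) (f k * poisson_pmf rate k)%:E else (f 0%N)%:E.
Proof.
move=> f0; rewrite integral_nat_RV//; case: ifPn => r0.
  apply: eq_eseriesr => k _; rewrite lawY /poisson_prob r0 esum_set1//.
  by rewrite lee_fin poisson_pmf_ge0.
rewrite (nneseriesD1 (n := 0%N))//; last first.
  by move=> k _; rewrite mule_ge0// lee_fin.
rewrite eseries0 => [|k _ /= k0].
  by rewrite adde0 lawY /poisson_prob (negbTE r0) diracE mem_set// mule1.
rewrite lawY /poisson_prob (negbTE r0) diracE memNset ?mule0//= => k00.
by rewrite -k00 in k0.
Qed.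

(** Read off from the total probability of the law of [Y], without summing the exponential
    series. *)
Lemma poisson_mass : (0 < rate)%R ->
  \sum_(0 <= k <oo) (1 * poisson_pmf rate k)%:E = 1.
Proof.
move=> r0; have := integral_poisson_law (f := fun=> 1%R) (fun=> ler01).
rewrite r0 => <-.
exact: integral_probability_cst.
Qed.

Lemma poisson_mean : \int[P]_w (Y w)%:R%:E = rate%:E.
Proof.
rewrite (integral_poisson_law (f := fun k => k%:R))//.
case: ifPn => r0; last first.
  by congr EFin; apply/eqP; rewrite eq_le rate0 leNgt r0.
rewrite nneseries_shift ?mul0r//; last first.
  by move=> k; rewrite lee_fin mulr_ge0// poisson_pmf_ge0.
have mass1 := poisson_mass r0.
under eq_eseriesr do rewrite poisson_pmf_recl// EFinM -[poisson_pmf _ _]mul1r.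
rewrite nneseriesZl; first by rewrite mass1 mule1.
by move=> k _; rewrite lee_fin mulr_ge0// poisson_pmf_ge0.
Qed.

Lemma poisson_second_moment :
  \int[P]_w ((Y w)%:R * (Y w)%:R)%:E = (rate ^+ 2 + rate)%:E.
Proof.
have [r0|r0] := ltP 0%R rate; last first.
  rewrite (integral_poisson_law (f := fun k => k%:R * k%:R)%R)//.
  have -> : rate = 0%R by apply/eqP; rewrite eq_le rate0 r0.
  by rewrite ltxx mul0r expr0n addr0.
have pmf0 k : 0 <= (poisson_pmf rate k)%:E by rewrite lee_fin poisson_pmf_ge0.
rewrite (integral_poisson_law (f := fun k => k%:R * k%:R)%R) ?r0//.
rewrite nneseries_shift ?mul0r//; last first.
  by move=> k; rewrite EFinM mule_ge0// lee_fin mulr_ge0.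
have mean := integral_poisson_law (f := fun k => k%:R) (fun k => ler0n R k).
rewrite poisson_mean r0 in mean.
have mass1 := poisson_mass r0.
(* One factor [k.+1] is absorbed by the recursion of the mass function; the other splits as [k + 1]
   and leaves the mean and the total mass. *)
have step k : (k.+1%:R * k.+1%:R * poisson_pmf rate k.+1)%:E =
    rate%:E * ((k%:R * poisson_pmf rate k)%:E + (1 * poisson_pmf rate k)%:E).
  rewrite -EFinD -EFinM -mulrA poisson_pmf_recl// mulrCA; congr (_ * _)%:E.
  by rewrite -mulrDl natr1.
under eq_eseriesr do rewrite step.
have n0 k : 0 <= (k%:R * poisson_pmf rate k)%:E.
  by rewrite EFinM mule_ge0// lee_fin.
have o0 k : 0 <= (1 * poisson_pmf rate k)%:E by rewrite mul1r.
rewrite nneseriesZl; last by move=> k _; rewrite adde_ge0.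
by rewrite nneseriesD// -mean mass1 -EFinD -EFinM mulrDr mulr1 expr2.
Qed.

End poisson.

Lemma bernoulli_mean (p : R) (Y : {RV P >-> bool}) : (0 <= p <= 1)%R ->
  has_bernoulli_law p Y -> \int[P]_w ((Y w)%:R : R)%:E = p%:E.
Proof.
move=> p01 lawY.
transitivity (\int[distribution P Y]_y ((y%:R : R)%:E)).
  by rewrite ge0_integral_distribution.
transitivity (\int[bernoulli_prob p]_y ((y%:R : R)%:E)).
  by apply: eq_measure_integral => A _ _; exact: lawY.
by rewrite integral_bernoulli_prob//= mule1 mule0 adde0.
Qed.

End discrete_moments.

(** * Measurability with respect to generated sigma-algebras *)

Lemma sub_measurable_wrt (T : Type) (G H : set (set T)) d'
    (T' : measurableType d') (f : T -> T') :
  G `<=` H -> measurable_wrt G f -> measurable_wrt H f.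
Proof. by move=> GH mf A mA; apply: (sub_sigma_algebra2 GH); exact: mf. Qed.

Section measurable_wrt_lemmas.
Context d (T : measurableType d) (R : realType) (G : set (set T)).

Lemma measurable_wrtE d' (T' : measurableType d') (f : T -> T') :
  measurable_wrt G f <->
  measurable_fun [set: g_sigma_algebraType G] (f : g_sigma_algebraType G -> T').
Proof.
split=> [mf _ A mA|mf A mA]; first by rewrite setTI; exact: mf.
by have := mf measurableT A mA; rewrite setTI.
Qed.

Lemma measurable_wrt_comp d1 (T1 : measurableType d1) d2 (T2 : measurableType d2)
    (f : T -> T1) (g : T1 -> T2) :
  measurable_fun setT g -> measurable_wrt G f -> measurable_wrt G (g \o f).
Proof. by move=> mg /measurable_wrtE mf; apply/measurable_wrtE/measurableT_comp. Qed.

Lemma measurable_wrtM (f g : T -> R) :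
  measurable_wrt G f -> measurable_wrt G g -> measurable_wrt G (f \* g).
Proof.
by move=> /measurable_wrtE mf /measurable_wrtE mg; apply/measurable_wrtE/measurable_funM.
Qed.

End measurable_wrt_lemmas.

(** The preimage splits over the countably many values of [Y]. This handles sums whose number of
    terms is random. *)
Lemma measurable_fun_nat_index d (T : measurableType d) d' (T' : measurableType d')
    (Y : T -> nat) (F : nat -> T -> T') :
  measurable_fun setT Y -> (forall n, measurable_fun setT (F n)) ->
  measurable_fun setT (fun w => F (Y w) w).
Proof.
move=> mY mF _ A mA; rewrite setTI.
have -> : (fun w => F (Y w) w) @^-1` A =
    \bigcup_n (Y @^-1` [set n] `&` F n @^-1` A).
  apply/seteqP; split=> [w Aw|w [n _ [/= -> //]]].
  by exists (Y w).
apply: bigcup_measurable => n _; apply: measurableI.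
  by have := mY measurableT [set n] I; rewrite setTI; exact.
by have := mF n measurableT A mA; rewrite setTI.
Qed.

Lemma measurable_addn d (T : measurableType d) (Y Z : T -> nat) :
  measurable_fun setT Y -> measurable_fun setT Z ->
  measurable_fun setT (fun w => Y w + Z w)%N.
Proof.
move=> mY mZ; apply: (measurable_fun_nat_index (F := fun n w => (n + Z w)%N) mY).
by move=> n; exact: measurableT_comp.
Qed.

Lemma measurable_thinning d (T : measurableType d) (Y : T -> nat)
    (I : nat -> T -> bool) :
  measurable_fun setT Y -> (forall j, measurable_fun setT (I j)) ->
  measurable_fun setT (thinning I Y).
Proof.
move=> mY mI; rewrite /thinning.
apply: (measurable_fun_nat_index (F := fun n w => \sum_(j < n) I j w)%N mY) => n.
elim: n => [|n IH].
  by under eq_fun do rewrite big_ord0; exact: measurable_cst.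
under eq_fun do rewrite big_ord_recr /=.
by apply: measurable_addn => //; exact: (measurableT_comp (f := nat_of_bool)).
Qed.

Lemma measurable_compound_sum d (T : measurableType d) (R : realType)
    (Y : T -> nat) (B : nat -> T -> R) :
  measurable_fun setT Y -> (forall j, measurable_fun setT (B j)) ->
  measurable_fun setT (compound_sum Y B).
Proof.
move=> mY mB; rewrite /compound_sum.
apply: (measurable_fun_nat_index (F := fun n w => \sum_(j < n) B j w) mY) => n.
exact: measurable_sum.
Qed.

(** * Moments of the counts *)

(* One generation of the tree: [M] is the count at the parent, [L] the
   innovation at the child and [U] the count at an earlier vertex. *)
Section thinning_step.
Context d (T : measurableType d) (R : realType) (P : probability T R).
Local Open Scope ereal_scope.
Variables (U M L : T -> nat) (I : nat -> T -> bool) (p rate : R).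
(** Two separations are required. [Gp] and [Gf] part the earlier counts from the marks and
    innovation of the child; [Gm] and [Gl] part the thinned sum, marks included, from the
    innovation, for the cross term of the square. *)
Variables Gp Gf Gm Gl : set (set T).
Hypotheses (mGp : Gp `<=` measurable) (mGf : Gf `<=` measurable)
  (mGm : Gm `<=` measurable) (mGl : Gl `<=` measurable).
Hypotheses (Gpf : independent_classes P <<s Gp>> <<s Gf>>)
  (Gml : independent_classes P <<s Gm>> <<s Gl>>).
Hypotheses (mU : measurable_wrt Gp U) (mM : measurable_wrt Gp M)
  (mI : forall j, measurable_wrt Gf (I j)) (mL : measurable_wrt Gf L).
Hypotheses (mM' : measurable_wrt Gm M) (mI' : forall j, measurable_wrt Gm (I j))
  (mL' : measurable_wrt Gl L).
Hypothesis p01 : (0 <= p <= 1)%R.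
Hypothesis meanI : forall j, \int[P]_w ((I j w)%:R : R)%:E = p%:E.
Hypothesis pairI : forall j k, j <> k ->
  \int[P]_w ((I j w)%:R * (I k w)%:R : R)%:E = (p * p)%:E.
Hypothesis meanL : \int[P]_w ((L w)%:R : R)%:E = rate%:E.
Hypothesis sqrL :
  \int[P]_w ((L w)%:R * (L w)%:R : R)%:E = (rate ^+ 2 + rate)%:E.

Let N w := (thinning I M w + L w)%N.
Let t : T -> R := compound_sum M (fun j w => (I j w)%:R).

Let NE w : (N w)%:R = (t w + (L w)%:R)%R.
Proof. by rewrite /N natrD /thinning natr_sum. Qed.

Let wrt_natr G (Y : T -> nat) :
  measurable_wrt G Y -> measurable_wrt G (fun w => (Y w)%:R : R).
Proof. exact: measurable_wrt_comp. Qed.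

Let wrt_ind G (Y : T -> nat) j :
  measurable_wrt G Y -> measurable_wrt G (fun w => (j < Y w)%N%:R : R).
Proof. exact: (measurable_wrt_comp (g := fun n => (j < n)%N%:R : R)). Qed.

Let wrt_bool G (Y : T -> bool) :
  measurable_wrt G Y -> measurable_wrt G (fun w => (Y w)%:R : R).
Proof. exact: (measurable_wrt_comp (g := fun b : bool => b%:R : R)). Qed.

Let mMT : measurable_fun setT M. Proof. exact: (measurable_wrtT mGp). Qed.
Let mLT : measurable_fun setT L. Proof. exact: (measurable_wrtT mGf). Qed.
Let mIT j : measurable_fun setT (fun w => (I j w)%:R : R).
Proof. exact: (measurable_wrtT mGf (wrt_bool (mI j))). Qed.
Let mt : measurable_fun setT t. Proof. exact: measurable_compound_sum. Qed.
Let t0 w : (0 <= t w)%R. Proof. by apply: sumr_ge0. Qed.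
Let mLR : measurable_fun setT (fun w => (L w)%:R : R).
Proof. exact: (measurable_wrtT mGf (wrt_natr mL)). Qed.

Let integral_thinM (K : T -> nat) : measurable_wrt Gp K ->
  \int[P]_w ((K w)%:R * t w)%:E = p%:E * \int[P]_w ((K w)%:R * (M w)%:R)%:E.
Proof.
move=> mK; have mKT := measurable_wrtT mGp mK.
have one0 (j : nat) (w : T) : (0 <= 1 :> R)%R by exact: ler01.
have mone (j : nat) : measurable_fun setT (fun _ : T => 1%R : R).
  exact: measurable_cst.
(* The count [K] is read as a compound sum of ones, so that the product formula applies. [K] is [U]
   for the covariance and the constant 1 for the mean. *)
under eq_integral do rewrite -compound_sum1.
rewrite (integral_compound_sumM_factor mKT mMT mone mIT one0 _ (c := p))//.
move=> j k; under eq_integral do rewrite mul1r.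
rewrite (@independent_integralM _ _ _ _ Gp Gf
  (fun w => (j < K w)%N%:R * (k < M w)%N%:R)%R (fun w => (I k w)%:R)%R)//.
- by rewrite meanI muleC.
- by apply: measurable_wrtM; exact: wrt_ind.
- exact: wrt_bool.
Qed.

Lemma thinning_step_cov :
  \int[P]_w ((U w)%:R * (N w)%:R)%:E =
  p%:E * \int[P]_w ((U w)%:R * (M w)%:R)%:E +
  rate%:E * \int[P]_w (U w)%:R%:E.
Proof.
under eq_integral do rewrite NE mulrDr EFinD.
have mUR := measurable_wrtT mGp (wrt_natr mU).
rewrite ge0_integralD//.
- rewrite integral_thinM//; congr (_ + _).
  rewrite (independent_integralM mGp mGf Gpf)//; [|exact: wrt_natr..].
  by rewrite meanL muleC.
- by move=> w _; rewrite lee_fin mulr_ge0.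
- by apply/measurable_EFinP/measurable_funM.
- by apply/measurable_EFinP/measurable_funM.
Qed.

Let integral_thin : \int[P]_w (t w)%:E = p%:E * \int[P]_w (M w)%:R%:E.
Proof.
have m1 : measurable_wrt Gp (fun _ : T => 1%N).
  by apply/measurable_wrtE; exact: measurable_cst.
have := integral_thinM m1.
by under eq_integral do rewrite mul1r; move=> ->;
  under eq_integral do rewrite mul1r.
Qed.

Lemma thinning_step_mean :
  \int[P]_w (N w)%:R%:E = p%:E * \int[P]_w (M w)%:R%:E + rate%:E.
Proof.
under eq_integral do rewrite NE EFinD.
rewrite ge0_integralD//.
- by rewrite integral_thin meanL.
- by move=> w _; rewrite lee_fin.
- exact/measurable_EFinP.
- exact/measurable_EFinP.
Qed.

Let le_integral_thin_sqr : \int[P]_w (t w * t w)%:E <=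
  (p * p)%:E * \int[P]_w ((M w)%:R * (M w)%:R)%:E +
  (p - p * p)%:E * \int[P]_w (M w)%:R%:E.
Proof.
have [p0 p1] := andP p01.
(* Two distinct marks have mixed moment [p * p], while a mark equals its own square and has mean
   [p]; the diagonal excess is therefore [p - p * p]. *)
have pp : (0 <= p - p * p)%R by rewrite subr_ge0 ler_piMl.
apply: le_integral_compound_sum_sqr => //; first by rewrite mulr_ge0.
move=> j k; rewrite (@independent_integralM _ _ _ _ Gp Gf
  (fun w => (j < M w)%N%:R * (k < M w)%N%:R)%R
  (fun w => (I j w)%:R * (I k w)%:R)%R)//.
- rewrite muleC lee_wpmul2r//.
    by apply: integral_ge0 => w _; rewrite lee_fin mulr_ge0.
  have [->|/eqP kj] := eqVneq k j.
    under eq_integral do rewrite -natrM mulnb andbb.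
    by rewrite meanI mul1r addrC subrK.
  by rewrite pairI ?mul0r ?addr0// => jk; apply: kj.
- by apply: measurable_wrtM; exact: wrt_ind.
- by apply: measurable_wrtM; exact: wrt_bool.
Qed.

Let wrt_t : measurable_wrt Gm t.
Proof.
apply/measurable_wrtE/measurable_compound_sum; first exact/measurable_wrtE.
by move=> j; apply/measurable_wrtE; exact: wrt_bool.
Qed.

Lemma thinning_step_sqr : \int[P]_w ((N w)%:R * (N w)%:R)%:E <=
  (p * p)%:E * \int[P]_w ((M w)%:R * (M w)%:R)%:E +
  (p - p * p)%:E * \int[P]_w (M w)%:R%:E +
  ((2 * rate * p)%:E * \int[P]_w (M w)%:R%:E + (rate ^+ 2 + rate)%:E).
Proof.
have NN w : ((N w)%:R * (N w)%:R)%:E =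
    (t w * t w)%:E + (2%:E * (t w * (L w)%:R)%:E + ((L w)%:R * (L w)%:R)%:E).
  by rewrite NE -EFinM -!EFinD; congr EFin; ring.
under eq_integral do rewrite NN.
have mtL : measurable_fun setT (fun w => (t w * (L w)%:R)%:E).
  exact/measurable_EFinP/measurable_funM.
have mLL : measurable_fun setT (fun w => ((L w)%:R * (L w)%:R : R)%:E).
  exact/measurable_EFinP/measurable_funM.
have m2 : measurable_fun setT (fun w => 2%:E * (t w * (L w)%:R)%:E).
  by apply/measurable_EFinP/measurable_funM => //; exact/measurable_EFinP.
have tL0 w : 0 <= (t w * (L w)%:R)%:E by rewrite lee_fin mulr_ge0.
have tL20 w : 0 <= 2%:E * (t w * (L w)%:R)%:E by rewrite mule_ge0// lee_fin.
have LL0 w : 0 <= ((L w)%:R * (L w)%:R : R)%:E by rewrite lee_fin mulr_ge0.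
have mtt : measurable_fun setT (fun w => (t w * t w)%:E).
  exact/measurable_EFinP/measurable_funM.
have mrest := emeasurable_funD m2 mLL.
have tt0 w : 0 <= (t w * t w)%:E by rewrite lee_fin mulr_ge0.
have rest0 w : 0 <= 2%:E * (t w * (L w)%:R)%:E + ((L w)%:R * (L w)%:R)%:E.
  exact: adde_ge0.
rewrite ge0_integralD//.
rewrite leeD//.
rewrite ge0_integralD// sqrL ge0_integralZl_EFin//.
rewrite (independent_integralM mGm mGl Gml)//; last exact: wrt_natr.
by rewrite meanL integral_thin [X in 2%:E * X]muleC !muleA -!EFinM.
Qed.

End thinning_step.

Section sigma_of_lemmas.
Context d (T : measurableType d).

Lemma sigma_ofP d' (T' : measurableType d') (Y : T -> T') (A : set T') :
  measurable A -> sigma_of Y (Y @^-1` A).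
Proof. by move=> mA; exists A => //; rewrite setTI. Qed.

Lemma sigma_ofT d' (T' : measurableType d') (Y : T -> T') : sigma_of Y setT.
Proof. by rewrite -(preimage_setT Y); exact: sigma_ofP. Qed.

Lemma setI_closed_sigma_of d' (T' : measurableType d') (Y : T -> T') :
  setI_closed (sigma_of Y).
Proof.
move=> _ _ [A mA <-] [B mB <-]; rewrite !setTI -preimage_setI.
exact/sigma_ofP/measurableI.
Qed.

Lemma sigma_of_measurable d' (T' : measurableType d') (Y : T -> T') :
  measurable_fun setT Y -> sigma_of Y `<=` measurable.
Proof. by move=> mY _ [A mA <-]; exact: mY. Qed.

End sigma_of_lemmas.

Section thinning_parameters.
Context (R : realType).
Implicit Types a x y u : R.

Lemma thinning_prob01 a x y : 0 < a <= Num.min (Num.sqrt (x / y)) (Num.sqrt (y / x)) ->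
  0 < x -> 0 < y -> 0 <= a * Num.sqrt (y / x) <= 1.
Proof.
move=> /andP[a0]; rewrite le_min => /andP[ax _] x0 y0.
apply/andP; split; first by rewrite mulr_ge0 ?sqrtr_ge0// ltW.
apply: le_trans (ler_wpM2r (sqrtr_ge0 _) ax) _.
rewrite -sqrtrM; last by rewrite divr_ge0 ?ltW.
by rewrite (_ : x / y * (y / x) = 1) ?sqrtr1//; field; rewrite !gt_eqF.
Qed.

Lemma innovation_rate_ge0 a x y :
  0 < a <= Num.min (Num.sqrt (x / y)) (Num.sqrt (y / x)) ->
  0 < x -> 0 < y -> 0 <= y * (1 - a * Num.sqrt (x / y)).
Proof.
move=> axy x0 y0; apply: mulr_ge0; first exact: ltW.
rewrite minC in axy; have /andP[_] := thinning_prob01 axy y0 x0.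
by rewrite subr_ge0.
Qed.

(** Explains the normalisation of covariances: with [x] at the parent and [y] at the child, the
    square root in the thinning probability turns the normaliser of the parent into that of the
    child, and only [alpha] remains. *)
Lemma sqrtr_div_mul x y u : 0 < x -> 0 < y -> 0 < u ->
  Num.sqrt (y / x) * Num.sqrt (u * x) = Num.sqrt (u * y).
Proof.
move=> x0 y0 u0; rewrite -sqrtrM; last by rewrite divr_ge0 ?ltW.
congr Num.sqrt.
by field; rewrite gt_eqF.
Qed.

(** Both square root terms equal [a] times the square root of [x * y] and cancel. This keeps the
    mean at each vertex equal to its own [lambda]. *)
Lemma thinning_mean_param a x y : 0 < x -> 0 < y ->
  a * Num.sqrt (y / x) * x + y * (1 - a * Num.sqrt (x / y)) = y.
Proof.
move=> x0 y0; have xE : x = Num.sqrt (x * x) by rewrite -expr2 sqrtr_sqr gtr0_norm.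
have yE : y = Num.sqrt (y * y) by rewrite -expr2 sqrtr_sqr gtr0_norm.
have h1 : Num.sqrt (y / x) * x = Num.sqrt (x * y).
  by rewrite {2}xE sqrtr_div_mul.
have h2 : y * Num.sqrt (x / y) = Num.sqrt (x * y).
  by rewrite mulrC {2}yE sqrtr_div_mul// mulrC.
by rewrite -mulrA h1 mulrBr mulr1 mulrCA h2 addrC subrK.
Qed.

End thinning_parameters.

Section mpmrf_moments.
Context (V : choiceType) (W : set V) (E : rel V) (R : realType)
  (lambda : V -> R) (alpha : V -> V -> R) (rho : V)
  d (T : measurableType d) (P : probability T R)
  (L : V -> {RV P >-> nat}) (I : V -> nat -> {RV P >-> bool}) (N : V -> T -> nat)
  (abar : R).
Hypothesis construction : mpmrf_construction W E lambda alpha rho L I N.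
Hypotheses (Wrho : W rho) (symE : symmetric E).
Hypothesis EW : forall u v, E u v -> W u.
Hypothesis connW : forall v, W v -> exists n, walk E rho v n.
Hypothesis lambda_gt0 : forall v, 0 < lambda v.
Hypothesis alpha_min : forall u v, E u v ->
  0 < alpha u v <= Num.min (Num.sqrt (lambda u / lambda v))
                           (Num.sqrt (lambda v / lambda u)).
Hypothesis alpha_le : forall u v, E u v -> alpha u v <= abar.

Let pa := parent E rho.
Let h v := graph_dist E rho v.
Let p v := alpha (pa v) v * Num.sqrt (lambda v / lambda (pa v)).
Let rate v := lambda v * (1 - alpha (pa v) v * Num.sqrt (lambda (pa v) / lambda v)).
Let D := [set i : V + V * nat | match i with
           | inl v => W v
           | inr vj => W vj.1 /\ vj.1 <> rho end].
Let F (i : V + V * nat) := match i with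
           | inl v => sigma_of (L v)
           | inr vj => sigma_of (I vj.1 vj.2) end.
Let G (K : set (V + V * nat)) := \bigcup_(i in K) F i.
Let owner (i : V + V * nat) := match i with inl v => v | inr vj => vj.1 end.

Let FT i : D i -> F i setT. Proof. by case: i => [v|[v j]] _; exact: sigma_ofT. Qed.
Let FI i : D i -> setI_closed (F i).
Proof. by case: i => [v|[v j]] _; exact: setI_closed_sigma_of. Qed.
Let mF i : F i `<=` measurable.
Proof. by case: i => [v|[v j]]; exact: sigma_of_measurable. Qed.
Let mG K : G K `<=` measurable.
Proof. by move=> A [i _ FA]; exact: mF FA. Qed.

Let indG K1 K2 : K1 `<=` D -> K2 `<=` D -> K1 `&` K2 = set0 ->
  independent_classes P <<s G K1>> <<s G K2>>.
Proof.
case: construction => indep _ _ _ _ K1D K2D K12.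
exact: (independent_coalition indep FT FI (fun i _ => @mF i)).
Qed.

Let wrtL (K : set (V + V * nat)) v : K (inl v) -> measurable_wrt (G K) (L v).
Proof.
move=> Kv A mA; apply: sub_sigma_algebra; exists (inl v) => //.
exact: sigma_ofP.
Qed.

Let wrtI (K : set (V + V * nat)) v j :
  K (inr (v, j)) -> measurable_wrt (G K) (I v j).
Proof.
move=> Kv A mA; apply: sub_sigma_algebra; exists (inr (v, j)) => //.
exact: sigma_ofP.
Qed.

Let paP v : W v -> v <> rho -> [/\ W (pa v), E (pa v) v & h v = (h (pa v)).+1].
Proof.
move=> Wv vrho; have [n wn] := connW Wv.
by have [Epv hv] := parentP wn vrho; split=> //; exact: EW Epv.
Qed.

Let N_rec v : W v -> v <> rho ->
  N v = (fun w => thinning (I v) (N (pa v)) w + L v w)%N.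
Proof. by case: construction => _ _ _ _; apply. Qed.

(** A count is a function of the sources at its vertex and at its ancestors. Replacing the ancestors
    by all shallower vertices loses nothing here and makes the induction on depth immediate. *)
Let wrtN n (K : set (V + V * nat)) u : W u -> h u = n ->
  (forall i, D i -> (h (owner i) < n)%N \/ owner i = u -> K i) ->
  measurable_wrt (G K) (N u).
Proof.
elim: n K u => [|n IH] K u Wu hu Ku; have [urho|urho] := pselect (u = rho).
- case: construction => _ _ _ Nrho _; rewrite urho Nrho; apply: wrtL.
  by rewrite -urho; apply: Ku => //; right.
- by have [_ _] := paP Wu urho; rewrite hu.
- by move: hu; rewrite urho /h graph_distxx.
- have [Wp _ hp] := paP Wu urho; rewrite hu in hp; case: hp => hp.
  have wNp : measurable_wrt (G K) (N (pa u)).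
    apply: (IH _ _ Wp (esym hp)) => i Di iu; apply: Ku => //; left.
    by case: iu => [iu|->]; [exact: ltnW|rewrite -hp].
  have wI j : measurable_wrt (G K) (I u j) by apply: wrtI; apply: Ku => //; right.
  have wL : measurable_wrt (G K) (L u) by apply: wrtL; apply: Ku => //; right.
  rewrite (N_rec Wu urho); apply/measurable_wrtE/measurable_addn.
    apply: measurable_thinning; first exact/measurable_wrtE.
    by move=> j; exact/measurable_wrtE.
  exact/measurable_wrtE.
Qed.

Lemma measurable_mpmrf v : W v -> measurable_fun setT (N v).
Proof.
move=> Wv; apply: (measurable_wrtT (@mG D)).
by apply: (wrtN Wv erefl) => i.
Qed.

(** [past v] contains the sources of every other vertex, deeper ones included; independence from the
    sources of [v] holds for all of them. [thinned v] omits only the innovation of [v], so that it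
    still sees the marks. *)
Let past v := [set i | D i /\ owner i <> v].
Let future v := [set i | D i /\ owner i = v].
Let thinned v := [set i | D i /\ i <> inl v].
Let immigrant v : set (V + V * nat) := [set inl v].

Let pastD v : past v `<=` D. Proof. by move=> i []. Qed.
Let futureD v : future v `<=` D. Proof. by move=> i []. Qed.
Let thinnedD v : thinned v `<=` D. Proof. by move=> i []. Qed.
Let immigrantD v : W v -> immigrant v `<=` D. Proof. by move=> Wv _ ->. Qed.

Let ind_past v : independent_classes P <<s G (past v)>> <<s G (future v)>>.
Proof. by apply: indG => //; apply/seteqP; split=> // i [[_ ?] [_ ?]]. Qed.

Let ind_thinned v : W v ->
  independent_classes P <<s G (thinned v)>> <<s G (immigrant v)>>.
Proof.
move=> Wv; apply: indG => //; first exact: immigrantD.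
by apply/seteqP; split=> // i [[_ ?] ?].
Qed.

(** [N u] uses the sources of [u] and of vertices strictly shallower than [u]; none of these is
    [v]. *)
Let wrtN_past u v : W u -> u <> v -> (h u <= h v)%N ->
  measurable_wrt (G (past v)) (N u).
Proof.
move=> Wu uv huv; apply: (wrtN Wu erefl) => i Di ih; split=> // iv.
by case: ih; rewrite iv; [rewrite ltnNge huv|move=> vu; apply: uv].
Qed.

Let wrtN_pa v : W v -> v <> rho -> measurable_wrt (G (past v)) (N (pa v)).
Proof.
move=> Wv vrho; have [Wp _ hv] := paP Wv vrho; apply: wrtN_past => //.
  by move=> pv; move: hv; rewrite pv => /eqP; rewrite eqn_leq ltnn andbF.
by rewrite hv.
Qed.

Let p01 v : W v -> v <> rho -> 0 <= p v <= 1.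
Proof.
move=> Wv vrho; have [_ Epv _] := paP Wv vrho.
exact: (thinning_prob01 (alpha_min Epv)).
Qed.

Let rate_ge0 v : W v -> v <> rho -> 0 <= rate v.
Proof.
by move=> Wv vrho; have [_ Epv _] := paP Wv vrho; exact: (innovation_rate_ge0 (alpha_min Epv)).
Qed.

Local Open Scope ereal_scope.

Let meanL v : W v -> v <> rho -> \int[P]_w ((L v w)%:R : R)%:E = (rate v)%:E.
Proof.
move=> Wv vrho; case: construction => _ _ /(_ v Wv vrho)[lawL _] _ _.
by apply: poisson_mean => //; exact: rate_ge0.
Qed.

Let sqrL v : W v -> v <> rho ->
  \int[P]_w ((L v w)%:R * (L v w)%:R : R)%:E = (rate v ^+ 2 + rate v)%:E.
Proof.
move=> Wv vrho; case: construction => _ _ /(_ v Wv vrho)[lawL _] _ _.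
by apply: poisson_second_moment => //; exact: rate_ge0.
Qed.

Let meanI v j : W v -> v <> rho -> \int[P]_w ((I v j w)%:R : R)%:E = (p v)%:E.
Proof.
move=> Wv vrho; case: construction => _ _ /(_ v Wv vrho)[_ lawI] _ _.
by apply: bernoulli_mean => //; exact: p01.
Qed.

Let pairI v j k : W v -> v <> rho -> j <> k ->
  \int[P]_w ((I v j w)%:R * (I v k w)%:R : R)%:E = (p v * p v)%:E.
Proof.
move=> Wv vrho jk.
have wrt m : measurable_wrt (G [set inr (v, m)]) (fun w => (I v m w)%:R : R).
  apply: (measurable_wrt_comp (g := fun b : bool => b%:R : R)) => //.
  exact: wrtI.
rewrite (independent_integralM (@mG [set inr (v, j)]) (@mG [set inr (v, k)]))//.
  by rewrite !meanI.
by apply: indG => [_ -> //|_ -> //|]; apply/seteqP; split=> // i [-> []].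
Qed.

Lemma mpmrf_mean v : W v -> \int[P]_w ((N v w)%:R : R)%:E = (lambda v)%:E.
Proof.
move hv: (h v) => n; elim: n v hv => [|n IH] v hv Wv;
  have [vrho|vrho] := pselect (v = rho).
- case: construction => _ lawL _ Nrho _; rewrite vrho Nrho.
  by apply: poisson_mean => //; exact: ltW.
- by have [_ _] := paP Wv vrho; rewrite hv.
- by move: hv; rewrite vrho /h graph_distxx.
- have [Wp _ hp] := paP Wv vrho; rewrite hv in hp; case: hp => hp.
  rewrite (N_rec Wv vrho).
  rewrite (thinning_step_mean (@mG (past v)) (@mG (future v)) (@ind_past v)
    (wrtN_pa Wv vrho) _ _ (fun j => meanI j Wv vrho) (meanL Wv vrho)).
  + by rewrite IH// -EFinM -EFinD /p /rate thinning_mean_param.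
  + by move=> j; apply: wrtI.
  + exact: wrtL.
Qed.

Lemma mpmrf_second_moment v : W v -> \int[P]_w ((N v w)%:R * (N v w)%:R)%:E <=
  (lambda v * lambda v + lambda v)%:E.
Proof.
move hv: (h v) => n; elim: n v hv => [|n IH] v hv Wv;
  have [vrho|vrho] := pselect (v = rho).
- case: construction => _ lawL _ Nrho _; rewrite vrho Nrho.
  by rewrite (poisson_second_moment (ltW (lambda_gt0 rho)) lawL) lee_fin expr2.
- by have [_ _] := paP Wv vrho; rewrite hv.
- by move: hv; rewrite vrho /h graph_distxx.
have [Wp _ hp] := paP Wv vrho; rewrite hv in hp; case: hp => hp.
have wIf j : measurable_wrt (G (future v)) (I v j) by exact: wrtI.
have wLf : measurable_wrt (G (future v)) (L v) by exact: wrtL.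
rewrite (N_rec Wv vrho).
apply: le_trans (thinning_step_sqr (@mG (past v)) (@mG (future v))
  (@mG (thinned v)) (@mG (immigrant v)) (@ind_past v) (ind_thinned Wv)
  (wrtN_pa Wv vrho) wIf wLf _ _ _ (p01 Wv vrho)
  (fun j => meanI j Wv vrho) (fun j k => pairI Wv vrho (j := j) (k := k))
  (meanL Wv vrho) (sqrL Wv vrho)) _.
- apply: sub_measurable_wrt (wrtN_pa Wv vrho).
  by apply: bigcup_subset => i [Di iv]; split=> // iE; apply: iv; rewrite iE.
- by move=> j; apply: wrtI.
- exact: wrtL.
have pp : (0 <= p v * p v)%R by have /andP[? _] := p01 Wv vrho; rewrite mulr_ge0.
rewrite (mpmrf_mean Wp).
apply: le_trans (leeD (leeD (lee_wpmul2l _ (IH _ (esym hp) Wp)) (lexx _)) (lexx _)) _.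
  by rewrite lee_fin.
rewrite -!EFinM -!EFinD lee_fin.
(* Once [lambda v] is written this way the two sides are equal polynomials: the second moment of a
   Poisson law reproduces itself under one thinning step. *)
have <- : (p v * lambda (pa v) + rate v = lambda v)%R.
  exact: thinning_mean_param.
by rewrite le_eqVlt; apply/orP; left; apply/eqP; ring.
Qed.

(* An upper bound with some walk replaces the exact product of the parameters
   along the path from [u] to [v]; no uniqueness of paths is needed. *)
Lemma mpmrf_mixed_moment u v : W u -> W v -> exists n, walk E u v n /\
  \int[P]_w ((N u w)%:R * (N v w)%:R)%:E <=
    (lambda u * lambda v + Num.sqrt (lambda u * lambda v) * abar ^+ n)%:E.
Proof.
have [m] := ubnP (h u + h v); elim: m u v => // m IH.
(* The claim is symmetric, so [v] may be taken at least as deep as [u]. It is then [v] that moves to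
   its parent, because [N u] is independent of the marks and innovation of [v]; the sum of the
   depths drops by one. *)
suff wlg u v : W u -> W v -> (h u <= h v)%N -> (h u + h v < m.+1)%N ->
    exists n, walk E u v n /\ \int[P]_w ((N u w)%:R * (N v w)%:R)%:E <=
    (lambda u * lambda v + Num.sqrt (lambda u * lambda v) * abar ^+ n)%:E.
  move=> u v uvm Wu Wv; have [huv|hvu] := leqP (h u) (h v); first exact: wlg.
  have [|n [wn le]] := wlg v u Wv Wu (ltnW hvu); first by rewrite addnC.
  exists n; split; first exact: walk_sym.
  rewrite [X in (X + _)%R]mulrC [X in Num.sqrt X]mulrC.
  by under eq_integral do rewrite mulrC.
move=> Wu Wv huv uvm.
have [vrho|vrho] := pselect (v = rho).
  have urho : u = rho.
    have [//|/(paP Wu)[_ _ hu]] := pselect (u = rho).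
    by move: huv; rewrite hu vrho /h graph_distxx.
  exists 0%N; rewrite urho vrho; split; first exact: walk0.
  case: construction => _ lawL _ Nrho _; rewrite Nrho.
  rewrite (poisson_second_moment (ltW (lambda_gt0 rho)) lawL) lee_fin.
  by rewrite -expr2 expr0 mulr1 sqrtr_sqr gtr0_norm.
have [Wp Epv hv] := paP Wv vrho.
have [a0 ale] := (alpha_min Epv, alpha_le Epv).
have l0 := lambda_gt0; have [p0 p1] := andP (p01 Wv vrho).
have r0 := rate_ge0 Wv vrho.
have mean_param : (p v * lambda (pa v) + rate v = lambda v)%R.
  exact: thinning_mean_param.
have wIf j : measurable_wrt (G (future v)) (I v j) by exact: wrtI.
have wLf : measurable_wrt (G (future v)) (L v) by exact: wrtL.
have [uv|uv] := pselect (u = v).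
  exists 0%N; rewrite uv; split; first exact: walk0.
  rewrite expr0 mulr1 -expr2 sqrtr_sqr gtr0_norm// expr2.
  exact: mpmrf_second_moment.
have [|n [wn le]] := IH u (pa v) _ Wu Wp.
  by move: uvm; rewrite hv addnS ltnS.
exists n.+1; split; first exact: walk_rcons Epv.
rewrite (N_rec Wv vrho).
rewrite (thinning_step_cov (@mG (past v)) (@mG (future v)) (@ind_past v)
  (wrtN_past Wu uv huv) (wrtN_pa Wv vrho) wIf wLf (fun j => meanI j Wv vrho)
  (meanL Wv vrho)) mpmrf_mean//.
apply: le_trans (leeD (lee_wpmul2l _ le) (lexx _)) _; first by rewrite lee_fin.
rewrite -!EFinM -EFinD lee_fin.
have -> : (p v * (lambda u * lambda (pa v) +
      Num.sqrt (lambda u * lambda (pa v)) * abar ^+ n) + rate v * lambda u =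
    lambda u * (p v * lambda (pa v) + rate v) +
    p v * Num.sqrt (lambda u * lambda (pa v)) * abar ^+ n)%R by ring.
have -> : (p v * Num.sqrt (lambda u * lambda (pa v)) =
    alpha (pa v) v * Num.sqrt (lambda u * lambda v))%R.
  by rewrite /p -mulrA sqrtr_div_mul.
have abar0 : (0 <= abar)%R by apply: le_trans ale; case/andP: a0 => /ltW.
rewrite mean_param lerD2l exprS [leRHS]mulrCA -mulrA.
by rewrite ler_wpM2r// mulr_ge0 ?sqrtr_ge0// exprn_ge0.
Qed.

End mpmrf_moments.

(** * Transfer of the count moments to the given probability space *)

Section law_transfer.
Local Open Scope ereal_scope.

Lemma integral_ltn_indicators d (T : measurableType d) (R : realType)
    (P : probability T R) (N M : T -> nat) j k :
  measurable_fun setT N -> measurable_fun setT M ->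
  \int[P]_w ((j < N w)%N%:R * (k < M w)%N%:R : R)%:E =
    P [set w | (j < N w)%N /\ (k < M w)%N].
Proof.
move=> mN mM; set A := [set w | _ /\ _].
have mA : measurable A.
  have m (K : T -> nat) i : measurable_fun setT K ->
      measurable [set w | (i < K w)%N].
    by move=> mK; have := mK measurableT [set n | (i < n)%N] I; rewrite setTI; exact.
  by apply: measurableI; exact: m.
have := integral_indic P measurableT mA; rewrite setIT => <-.
apply: eq_integral => w _; rewrite indicE -natrM mulnb; congr (_%:R)%:E.
congr nat_of_bool; apply/idP/idP => [/andP[Nw Mw]|]; first exact: mem_set.
by rewrite inE => -[-> ->].
Qed.

(** Equality in law speaks of events only. A mixed moment of counts is the double series of the
    probabilities that they exceed [j] and [k], and these events depend on the coordinates in [W]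
    alone. *)
Lemma vector_law_integralM (V : Type) (W : set V) (R : realType)
    d (T : measurableType d) (P : probability T R) (N : V -> T -> nat)
    d' (T' : measurableType d') (P' : probability T' R) (N' : V -> T' -> nat)
    (f g : (V -> nat) -> nat) :
  (forall A, vector_law W P N A = vector_law W P' N' A) ->
  (forall k l : V -> nat, (forall v, W v -> k v = l v) -> f k = f l) ->
  (forall k l : V -> nat, (forall v, W v -> k v = l v) -> g k = g l) ->
  measurable_fun setT (fun w => f (N^~ w)) ->
  measurable_fun setT (fun w => g (N^~ w)) ->
  measurable_fun setT (fun w => f (N'^~ w)) ->
  measurable_fun setT (fun w => g (N'^~ w)) ->
  \int[P]_w ((f (N^~ w))%:R * (g (N^~ w))%:R : R)%:E =
  \int[P']_w ((f (N'^~ w))%:R * (g (N'^~ w))%:R : R)%:E.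
Proof.
move=> NN' fW gW mf mg mf' mg'; rewrite !integral_natrM//.
apply: eq_eseriesr => i _; apply: eq_eseriesr => j _.
rewrite !integral_ltn_indicators//.
have E d0 (T0 : measurableType d0) (P0 : probability T0 R) (N0 : V -> T0 -> nat) :
    P0 [set w | (i < f (N0^~ w))%N /\ (j < g (N0^~ w))%N] =
    vector_law W P0 N0 [set k | (i < f k)%N /\ (j < g k)%N].
  congr (P0 _); apply/seteqP; split=> [w fg|w [k [fk gk] kN]].
    by exists (N0^~ w).
  by rewrite /= -(fW _ _ kN) -(gW _ _ kN).
by rewrite !E.
Qed.

Lemma MPMRF_moments (V : choiceType) (W : set V) (E : rel V) (R : realType)
    (lambda : V -> R) (alpha : V -> V -> R) d (T : measurableType d)
    (P : probability T R) (N : V -> {RV P >-> nat}) (abar : R) :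
  MPMRF W E lambda alpha N -> symmetric E -> (forall u v, E u v -> W u) ->
  (forall u v, W u -> W v -> exists n, walk E u v n) ->
  (forall v, 0 < lambda v)%R ->
  (forall u v, E u v -> 0 < alpha u v <=
     Num.min (Num.sqrt (lambda u / lambda v)) (Num.sqrt (lambda v / lambda u)))%R ->
  (forall u v, E u v -> alpha u v <= abar)%R ->
  (forall u, W u -> \int[P]_w ((N u w)%:R : R)%:E = (lambda u)%:E) /\
  (forall u, W u -> \int[P]_w ((N u w)%:R * (N u w)%:R : R)%:E <=
     (lambda u * lambda u + lambda u)%:E) /\
  (forall u v, W u -> W v -> exists n, walk E u v n /\
    \int[P]_w ((N u w)%:R * (N v w)%:R)%:E <=
    (lambda u * lambda v + Num.sqrt (lambda u * lambda v) * abar ^+ n)%:E).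
Proof.
move=> [rho [Wrho [d' [T' [P' [L [I [N' [cN' NN']]]]]]]]] symE EW connW l0 amin ale.
have mN' u : W u -> measurable_fun setT (N' u).
  exact: (measurable_mpmrf cN' EW (connW _ ^~ Wrho)).
have NN2 u v : W u -> W v -> \int[P]_w ((N u w)%:R * (N v w)%:R : R)%:E =
    \int[P']_w ((N' u w)%:R * (N' v w)%:R : R)%:E.
  move=> Wu Wv; apply: (vector_law_integralM (f := fun k => k u)
    (g := fun k => k v) NN') => //; [by move=> k l; apply|by move=> k l; apply|..];
  exact: mN'.
split=> [u Wu|].
  rewrite -(mpmrf_mean cN' EW (connW _ ^~ Wrho) l0 amin Wu).
  have : \int[P]_w ((N u w)%:R * 1 : R)%:E = \int[P']_w ((N' u w)%:R * 1 : R)%:E.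
    apply: (vector_law_integralM (f := fun k => k u) (g := fun=> 1%N) NN') => //.
      by move=> k l; apply.
    exact: mN'.
  by under eq_integral do rewrite mulr1;
    under [X in _ = X -> _]eq_integral do rewrite mulr1.
split=> [u Wu|u v Wu Wv].
  by rewrite NN2//; exact: (mpmrf_second_moment cN' EW (connW _ ^~ Wrho) l0 amin).
have [n [wn le]] :=
  mpmrf_mixed_moment cN' symE EW (connW _ ^~ Wrho) l0 amin ale Wu Wv.
by exists n; rewrite NN2.
Qed.

End law_transfer.

(** * Moments of the claim totals at one vertex and at a pair of vertices *)

Lemma setI_closed_sigma_algebra (T : pointedType) (G : set (set T)) :
  setI_closed <<s G>>.
Proof.
move=> A B GA GB.
exact: (@measurableI _ (g_sigma_algebraType G) (A : set (g_sigma_algebraType G)) B).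
Qed.

Section claim_moments.
Context (V : choiceType) (W : set V) (R : realType)
  d0 (T0 : measurableType d0) (P0 : probability T0 R) (B0 : V -> {RV P0 >-> R})
  d (T : measurableType d) (P : probability T R)
  (N : V -> {RV P >-> nat}) (B : V -> nat -> {RV P >-> R}).
Hypothesis claims : claim_amounts W B0 N B.
Local Open Scope ereal_scope.

Let D := [set i : option V | if i is Some v then W v else True].
Let F (i : option V) := match i with
           | None => sigma_of_family W N
           | Some v => sigma_of_family setT (B v) end.
Let G (K : set (option V)) := \bigcup_(i in K) F i.

Let FT i : D i -> F i setT.
Proof. by case: i => [v|] _; exact: (@measurableT _ (g_sigma_algebraType _)). Qed.
Let FI i : D i -> setI_closed (F i).
Proof. by case: i => [v|] _; exact: setI_closed_sigma_algebra. Qed.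
Let mF i : F i `<=` measurable.
Proof.
by case: i => [v|]; apply: smallest_sub; [exact: sigma_algebra_measurable|
  move=> A [j _]; exact: sigma_of_measurable|exact: sigma_algebra_measurable|
  move=> A [j _]; exact: sigma_of_measurable].
Qed.
Let mG K : G K `<=` measurable.
Proof. by move=> A [i _ FA]; exact: mF FA. Qed.

Let indG K1 K2 : K1 `<=` D -> K2 `<=` D -> K1 `&` K2 = set0 ->
  independent_classes P <<s G K1>> <<s G K2>>.
Proof.
case: claims => _ _ indep K1D K2D K12.
exact: (independent_coalition indep FT FI (fun i _ => @mF i)).
Qed.

Let wrtN v : W v -> measurable_wrt (G [set None]) (N v).
Proof.
move=> Wv A mA; apply: sub_sigma_algebra; exists None => //.
by apply: sub_sigma_algebra; exists v => //; exact: sigma_ofP.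
Qed.

Let wrtB (K : set (option V)) v j : K (Some v) ->
  measurable_wrt (G K) (fun w => `|B v j w|%R).
Proof.
move=> Kv; apply: (measurable_wrt_comp (g := fun x : R => `|x|%R)) => //.
move=> A mA; apply: sub_sigma_algebra; exists (Some v) => //.
by apply: sub_sigma_algebra; exists j => //; exact: sigma_ofP.
Qed.

Lemma claim_integral (f : R -> R) v j : measurable_fun setT f ->
  (forall x, 0 <= f x)%R -> W v ->
  \int[P]_w (f (B v j w))%:E = \int[P0]_w (f (B0 v w))%:E.
Proof.
move=> mf f0 Wv; case: claims => law _ _.
have mf' : measurable_fun setT (fun x => (f x)%:E) by exact/measurable_EFinP.
have f0' x : 0 <= (f x)%:E by rewrite lee_fin.
have E d' (T' : measurableType d') (Q : probability T' R) (Y : {RV Q >-> R}) :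
    \int[Q]_w (f (Y w))%:E = \int[distribution Q Y]_x (f x)%:E.
  by rewrite ge0_integral_distribution.
by rewrite !E; apply: eq_measure_integral => A mA _; exact: law.
Qed.

Variables (b m : V -> R).
Hypothesis meanB : forall v, \int[P0]_w `|B0 v w|%:E = (b v)%:E.
Hypothesis sqrB : forall v, \int[P0]_w (B0 v w ^+ 2)%:E = (m v)%:E.

Let X v := compound_sum (N v) (fun j w => `|B v j w|%R).

Let mabsB v j : measurable_fun setT (fun w => `|B v j w|%R).
Proof. exact: measurableT_comp. Qed.

Let mean_absB v j : W v -> \int[P]_w `|B v j w|%:E = (b v)%:E.
Proof.
move=> Wv; rewrite -meanB.
by apply: (claim_integral (f := fun x => `|x|%R)) => //; exact: measurableT_comp.
Qed.

Let sqr_absB v j : W v -> \int[P]_w (`|B v j w| * `|B v j w|)%:E = (m v)%:E.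
Proof.
move=> Wv; rewrite -sqrB.
under eq_integral do rewrite -expr2 real_normK ?num_real//.
apply: (claim_integral (f := fun x => x ^+ 2)%R) => // x; exact: sqr_ge0.
Qed.

(** Two different hypotheses enter: independence of the sequences when the vertices differ,
    independence within one sequence when only the indices differ. *)
Let cross_absB u v j k : W u -> W v -> (u, j) <> (v, k) ->
  \int[P]_w (`|B u j w| * `|B v k w|)%:E = (b u * b v)%:E.
Proof.
move=> Wu Wv; have [<- ujk|uv _] := pselect (u = v); last first.
  rewrite (independent_integralM (@mG [set Some u]) (@mG [set Some v]))//.
  - by rewrite !mean_absB.
  - apply: indG => [_ -> //|_ -> //|]; apply/seteqP; split=> // i [-> []] //.
  - exact: wrtB.
  - exact: wrtB.
have jk : j <> k by move=> jk; apply: ujk; rewrite jk.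
case: claims => _ /(_ u Wu) indep _.
have mB i : sigma_of (B u i) `<=` measurable by exact: sigma_of_measurable.
have ind := independent_coalition indep (fun i _ => sigma_ofT (B u i))
  (fun i _ => @setI_closed_sigma_of _ _ _ _ (B u i)) (fun i _ => mB i)
  (@subsetT _ [set j]) (@subsetT _ [set k]).
have wrt i : measurable_wrt (\bigcup_(l in [set i]) sigma_of (B u l))
    (fun w => `|B u i w|%R).
  apply: (measurable_wrt_comp (g := fun x : R => `|x|%R)) => // A mA.
  by apply: sub_sigma_algebra; exists i => //; exact: sigma_ofP.
rewrite (independent_integralM _ _ (ind _) (wrt j) (wrt k))//.
- by rewrite !mean_absB.
- by move=> A [i _]; exact: mB.
- by move=> A [i _]; exact: mB.
- by apply/seteqP; split=> // i [-> ].
Qed.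

Let integral_claim_terms u v j k : W u -> W v ->
  \int[P]_w ((j < N u w)%N%:R * (k < N v w)%N%:R *
     (`|B u j w| * `|B v k w|))%:E =
  \int[P]_w ((j < N u w)%N%:R * (k < N v w)%N%:R)%:E *
  \int[P]_w (`|B u j w| * `|B v k w|)%:E.
Proof.
move=> Wu Wv.
have wrt i w : W w -> measurable_wrt (G [set None]) (fun x => (i < N w x)%N%:R : R).
  move=> Ww; apply: (measurable_wrt_comp (g := fun n => (i < n)%N%:R : R)) => //.
  exact: wrtN.
apply: (@independent_integralM _ _ _ _ (G [set None]) (G [set Some u; Some v])
  (fun w => (j < N u w)%N%:R * (k < N v w)%N%:R)%R
  (fun w => `|B u j w| * `|B v k w|)%R) => //.
- apply: indG => [_ -> //|_ [->|->] //|].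
  by apply/seteqP; split=> // i [-> []].
- by apply: measurable_wrtM; exact: wrt.
- by apply: measurable_wrtM; apply: wrtB; [left|right].
Qed.

Lemma claim_total_mean v : W v ->
  \int[P]_w (X v w)%:E = (b v)%:E * \int[P]_w (N v w)%:R%:E.
Proof.
move=> Wv.
have one0 (j : nat) (w : T) : (0 <= 1 :> R)%R by exact: ler01.
have mone (j : nat) : measurable_fun setT (fun _ : T => 1%R : R).
  exact: measurable_cst.
(* The mean is treated as a mixed moment whose second compound sum is the single term 1. *)
have m1 : measurable_fun setT (fun _ : T => 1%N) by exact: measurable_cst.
have mNv : measurable_fun setT (N v) by exact: measurable_funP.
have abs0 j w : (0 <= `|B v j w|)%R by exact: normr_ge0.
have factor j k : \int[P]_w ((j < N v w)%N%:R * (k < 1)%N%:R * (`|B v j w| * 1))%:E =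
    (b v)%:E * \int[P]_w ((j < N v w)%N%:R * (k < 1)%N%:R)%:E.
  under eq_integral do rewrite mulr1.
  have wNj : measurable_wrt (G [set None])
      (fun w => (j < N v w)%N%:R * (k < 1)%N%:R : R)%R.
    apply: (measurable_wrt_comp (g := fun n => (j < n)%N%:R * (k < 1)%N%:R : R)%R) => //.
    exact: wrtN.
  rewrite (@independent_integralM _ _ _ _ (G [set None]) (G [set Some v])
    (fun w => (j < N v w)%N%:R * (k < 1)%N%:R)%R (fun w => `|B v j w|)%R)//.
  - by rewrite mean_absB// muleC.
  - by apply: indG => [_ -> //|_ -> //|]; apply/seteqP; split=> // i [-> []].
  - exact: wrtB.
have := integral_compound_sumM_factor mNv m1 (mabsB v) mone abs0 one0 factor.
under eq_integral do rewrite compound_sum1 mulr1.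
by under [X in _ = _ * X -> _]eq_integral do rewrite mulr1.
Qed.

Lemma claim_total_mixed u v : W u -> W v -> u <> v ->
  \int[P]_w (X u w * X v w)%:E =
  (b u * b v)%:E * \int[P]_w ((N u w)%:R * (N v w)%:R)%:E.
Proof.
move=> Wu Wv uv.
have terms j k : \int[P]_w ((j < N u w)%N%:R * (k < N v w)%N%:R *
      (`|B u j w| * `|B v k w|))%:E =
    (b u * b v)%:E * \int[P]_w ((j < N u w)%N%:R * (k < N v w)%N%:R)%:E.
  have uvjk : (u, j) <> (v, k) by case.
  by rewrite (integral_claim_terms j k Wu Wv) (cross_absB Wu Wv uvjk) muleC.
exact: (integral_compound_sumM_factor (measurable_funP (N u))
  (measurable_funP (N v)) (mabsB u) (mabsB v) (fun _ _ => normr_ge0 _)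
  (fun _ _ => normr_ge0 _) terms).
Qed.

Lemma claim_total_sqr v : W v -> \int[P]_w (X v w * X v w)%:E <=
  (b v * b v)%:E * \int[P]_w ((N v w)%:R * (N v w)%:R)%:E +
  (m v)%:E * \int[P]_w (N v w)%:R%:E.
Proof.
move=> Wv.
have b0 : (0 <= b v)%R.
  by rewrite -lee_fin -meanB; apply: integral_ge0 => w _; rewrite lee_fin.
have m0 : (0 <= m v)%R.
  by rewrite -lee_fin -sqrB; apply: integral_ge0 => w _; rewrite lee_fin sqr_ge0.
apply: (le_integral_compound_sum_sqr (measurable_funP (N v)) (mabsB v)
  (fun _ _ => normr_ge0 _)) => //; first by rewrite mulr_ge0.
move=> j k; rewrite (integral_claim_terms j k Wv Wv) muleC.
apply: lee_wpmul2r.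
  by apply: integral_ge0 => w _; rewrite lee_fin mulr_ge0.
have [->|/eqP kj] := eqVneq k j.
  (* The diagonal excess is taken to be [m v] rather than the variance of a claim, whose
     nonnegativity would call for Jensen's inequality. *)
  by rewrite sqr_absB// mul1r lee_fin lerDr mulr_ge0.
have vjk : (v, j) <> (v, k) by move=> [] /esym.
by rewrite (cross_absB Wv Wv vjk) mul0r addr0.
Qed.

End claim_moments.

(** * Deviation of the total claim *)

Section deviation.
Local Open Scope ereal_scope.

Lemma measurable_deviation d (T : measurableType d) (R : realType)
    (Y : T -> R) (mu eps : R) : measurable_fun setT Y ->
  measurable [set w | (eps <= `|Y w - mu|)%R].
Proof.
move=> mY; have mabs : measurable_fun setT (fun w => `|Y w - mu|%R).
  by apply: measurableT_comp => //; exact: measurable_funB.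
have := mabs measurableT _ (measurable_itv `[eps, +oo[).
rewrite setTI; congr measurable; apply/seteqP.
by split=> w /=; rewrite in_itv/= andbT.
Qed.

Lemma deviation_bound d (T : measurableType d) (R : realType)
    (P : probability T R) (S : T -> R) (mu Q eps : R) :
  measurable_fun setT S -> (forall w, 0 <= S w)%R -> (0 <= mu)%R ->
  \int[P]_w (S w)%:E = mu%:E -> \int[P]_w (S w * S w)%:E <= (mu ^+ 2 + Q)%:E ->
  (0 < eps)%R -> P [set w | (eps <= `|S w - mu|)%R] <= (Q / eps ^+ 2)%:E.
Proof.
move=> mS S0 mu0 ES ESS eps0; set A := [set w | _].
have mA : measurable A by exact: measurable_deviation.
have mD : measurable_fun setT (fun w => S w - mu)%R.
  exact: measurable_funB.
have mD2 : measurable_fun setT (fun w => ((S w - mu) ^+ 2)%:E).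
  by apply/measurable_EFinP; exact: (measurable_funX 2 mD).
have sq0 w : 0 <= ((S w - mu) ^+ 2)%:E by rewrite lee_fin sqr_ge0.
have mS2 : measurable_fun setT (fun w => (2 * mu * S w)%:E).
  by apply/measurable_EFinP; exact: measurable_funM.
have S20 w : 0 <= (2 * mu * S w)%:E by rewrite lee_fin !mulr_ge0.
have mSS : measurable_fun setT (fun w => (S w * S w)%:E).
  by apply/measurable_EFinP; exact: measurable_funM.
have SS0 w : 0 <= (S w * S w)%:E by rewrite lee_fin mulr_ge0.
have var : \int[P]_w ((S w - mu) ^+ 2)%:E <= Q%:E.
  (* The square is expanded with the cross term moved to the left, so that only nonnegative
     functions are integrated. *)
  have : \int[P]_w (((S w - mu) ^+ 2)%:E + (2 * mu * S w)%:E) =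
      \int[P]_w ((S w * S w)%:E + (mu ^+ 2)%:E).
    by apply: eq_integral => w _; rewrite -!EFinD; congr EFin; ring.
  rewrite !ge0_integralD//; last first.
    by move=> w _; rewrite lee_fin sqr_ge0.
  under [X in _ + X = _ -> _]eq_integral do rewrite EFinM.
  have mS' : measurable_fun setT (fun w => (S w)%:E) by exact/measurable_EFinP.
  have S0' w : 0 <= (S w)%:E by rewrite lee_fin.
  rewrite ge0_integralZl_EFin ?mulr_ge0// ES.
  rewrite (_ : \int[P]_w (mu ^+ 2)%:E = (mu ^+ 2)%:E); last first.
    exact: integral_probability_cst.
  move=> E; have := leeD2r (mu ^+ 2)%:E ESS; rewrite -E -EFinM -EFinD.
  rewrite -leeBrDr// -EFinB => /le_trans; apply; rewrite lee_fin.
  by rewrite le_eqVlt; apply/orP; left; apply/eqP; ring.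
have e20 : (0 < eps ^+ 2)%R by rewrite exprn_gt0.
rewrite EFinM lee_pdivlMr// muleC; apply: le_trans var.
have := integral_indic P measurableT mA; rewrite setIT => <-.
rewrite -ge0_integralZl_EFin//; last 2 first.
- exact/measurable_EFinP.
- exact: ltW.
apply: ge0_le_integral => //.
- by move=> w _; rewrite mule_ge0// lee_fin ltW.
- by apply/measurable_EFinP; apply: measurable_funM.
move=> w _; rewrite indicE; have [wA|wA] := boolP (w \in A).
  have epsw : (eps <= `|S w - mu|)%R by move: wA; rewrite inE.
  rewrite mule1 lee_fin -[leRHS]real_normK ?num_real//.
  by rewrite ler_sqr ?nnegrE ?normr_ge0// (ltW eps0).
by rewrite mule0.
Qed.

Lemma second_moment_sum d (T : measurableType d) (R : realType)
    (P : probability T R) (V : eqType) (s : seq V) (X : V -> T -> R)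
    (x : V -> R) (r : V -> V -> R) :
  (forall v, v \in s -> measurable_fun setT (X v)) ->
  (forall v w, 0 <= X v w)%R ->
  (forall u v, u \in s -> v \in s ->
     \int[P]_w (X u w * X v w)%:E <= (x u * x v + r u v)%:E) ->
  \int[P]_w ((\sum_(v <- s) X v w) * (\sum_(v <- s) X v w))%:E <=
    ((\sum_(v <- s) x v) ^+ 2 + \sum_(u <- s) \sum_(v <- s) r u v)%:E.
Proof.
move=> mX X0 XX.
(* Exchanging the integral with a finite sum asks for measurability at every index, hence the
   extension by zero outside [s]. *)
pose Y v := if v \in s then X v else cst 0%R.
have mY v : measurable_fun setT (Y v).
  by rewrite /Y; case: ifPn => [/mX//|_]; exact: measurable_cst.
have Y0 v w : (0 <= Y v w)%R by rewrite /Y; case: ifPn.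
have E w : ((\sum_(v <- s) X v w) * (\sum_(v <- s) X v w))%:E =
    \sum_(u <- s) \sum_(v <- s) (Y u w * Y v w)%:E.
  rewrite mulr_suml -sumEFin; apply: eq_big_seq => u us.
  rewrite mulr_sumr -sumEFin; apply: eq_big_seq => v vs.
  by rewrite /Y us vs.
under eq_integral do rewrite E.
have mYY u v : measurable_fun setT (fun w => (Y u w * Y v w)%:E).
  by apply/measurable_EFinP; exact: measurable_funM.
have YY0 u v w : 0 <= (Y u w * Y v w)%:E by rewrite lee_fin mulr_ge0.
rewrite ge0_integral_sum//; last 2 first.
- by move=> u; apply: emeasurable_sum.
- by move=> u w _; apply: sume_ge0.
rewrite expr2 mulr_suml -big_split -sumEFin.
rewrite big_seq [leRHS]big_seq; apply: lee_sum => u us.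
rewrite ge0_integral_sum// mulr_sumr -big_split -sumEFin.
rewrite big_seq [leRHS]big_seq; apply: lee_sum => v vs.
by rewrite /Y us vs; exact: XX.
Qed.

End deviation.

(* Pairs joined by a walk of length at most [k] number at most
   [size s * chi.+1 ^ k]; every other pair contributes at most [abar ^+ k]. *)
Lemma sum_geometric_walks (V : choiceType) (E : rel V) (R : realType)
    (nbrs : V -> seq V) (chi : nat) (s : seq V) (abar : R)
    (f : V -> V -> nat) (k : nat) :
  (forall u v, E u v = (v \in nbrs u)) -> (forall u, size (nbrs u) = chi) ->
  uniq s -> (forall u v, u \in s -> v \in s -> walk E u v (f u v)) ->
  0 <= abar <= 1 ->
  \sum_(u <- s) \sum_(v <- s) abar ^+ f u v <=
    (size s)%:R * (chi.+1 ^ k)%:R + (size s)%:R ^+ 2 * abar ^+ k.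
Proof.
move=> nbrsP sz us wf /andP[a0 a1].
have term u v : u \in s -> v \in s ->
    abar ^+ f u v <= (v \in reach nbrs k u)%:R + abar ^+ k.
  move=> uS vS; have [fk|kf] := leqP (f u v) k.
    rewrite (walk_reach nbrsP (wf u v uS vS) fk).
    by rewrite ler_wpDr ?exprn_ge0// exprn_ile1.
  by rewrite ler_wpDl// ler_wiXn2l// ltnW.
have row u : u \in s -> \sum_(v <- s) abar ^+ f u v <=
    (chi.+1 ^ k)%:R + (size s)%:R * abar ^+ k.
  move=> uS; rewrite big_seq.
  apply: le_trans (ler_sum _ (fun v vS => term u v uS vS)) _.
  rewrite -big_seq big_split /= lerD//; last first.
    by rewrite big_const_seq count_predT iter_addr_0 mulr_natl.
  rewrite (_ : \sum_(v <- s) _ = (count (mem (reach nbrs k u)) s)%:R); last first.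
    by rewrite -sum1_count natr_sum [RHS]big_mkcond; apply: eq_bigr => v _ /=; case: ifP.
  rewrite ler_nat -size_filter -(size_reach sz k u).
  apply: uniq_leq_size; first exact: filter_uniq.
  by move=> v; rewrite mem_filter => /andP[].
rewrite big_seq; apply: le_trans (ler_sum _ row) _.
rewrite -big_seq big_const_seq count_predT iter_addr_0.
by rewrite -[leLHS]mulr_natl mulrDr expr2 !mulrA.
Qed.

(** Equality in law on the negative half-line carries almost sure nonnegativity from [B0 v] to each
    copy, and countably many copies share one null set. *)
Lemma claim_total_abs (V : choiceType) (W : set V) (R : realType)
    d0 (T0 : measurableType d0) (P0 : probability T0 R) (B0 : V -> {RV P0 >-> R})
    d (T : measurableType d) (P : probability T R)
    (N : V -> {RV P >-> nat}) (B : V -> nat -> {RV P >-> R}) v :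
  claim_amounts W B0 N B -> {ae P0, forall w, 0 <= B0 v w} -> W v ->
  {ae P, forall w, compound_sum (N v) (B v) w =
    compound_sum (N v) (fun j w => `|B v j w|) w}.
Proof.
move=> [law _ _] B00 Wv.
have neg0 d' (T' : measurableType d') (Q : probability T' R) (Y : {RV Q >-> R}) :
    measurable (~` [set w | 0 <= Y w]) /\
    Q (~` [set w | 0 <= Y w]) = distribution Q Y [set` `]-oo, 0[ ].
  have -> : ~` [set w | 0 <= Y w] = Y @^-1` [set` `]-oo, 0[ ].
    apply/seteqP; split=> w /=; rewrite in_itv/=.
      by move/negP; rewrite -ltNge.
    by move=> ?; apply/negP; rewrite -ltNge.
  by split=> //; exact: measurable_funPTI.
have Bj j : {ae P, forall w, 0 <= B v j w}.
  have [m1 e1] := neg0 _ _ _ (B v j); have [m2 e2] := neg0 _ _ _ (B0 v).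
  have neg : P.-negligible (~` [set w | 0 <= B v j w]).
    apply/(negligibleP P m1); apply: (etrans e1); rewrite law// -e2.
    exact/(negligibleP P0 m2)/B00.
  exact: neg.
have := ae_foralln Bj; apply: filterS => w Bw.
by apply: eq_bigr => j _; rewrite ger0_norm.
Qed.

(* The claims are only almost surely nonnegative: moments are computed for the
   sums [Xa] of the absolute values. *)
Section bethe_total.
Context (R : realType) (chi : nat) (V : choiceType) (E : rel V) (r : V).
Context (lambda : V -> R) (alpha : V -> V -> R).
Context d0 (T0 : measurableType d0) (P0 : probability T0 R)
  (B0 : V -> {RV P0 >-> R}).
Context d (T : measurableType d) (P : probability T R).
Context (N : V -> {RV P >-> nat}) (B : V -> nat -> {RV P >-> R}) (n : nat).
Context (lambda_max beta m2 abar : R).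
Let W := ball_vertices E r n.
Let s : seq V := fset_set W.
Let X v := compound_sum (N v) (B v).
Hypothesis bethe : bethe_lattice E chi.
Hypothesis adm : admissible E lambda alpha.
Hypothesis N_law : MPMRF W (induced_edges E W) lambda alpha N.
Hypothesis B_law : claim_amounts W B0 N B.
Hypothesis B0_ge0 : forall v, {ae P0, forall w, 0 <= B0 v w}.
Hypothesis lambda_le : forall v, lambda v <= lambda_max.
Hypothesis alpha_le : forall u v, E u v -> alpha u v <= abar.
Hypothesis abar01 : 0 <= abar <= 1.
Hypothesis mean_le : forall v, (\int[P0]_w `|B0 v w|%:E <= beta%:E)%E.
Hypothesis sqr_le : forall v, (\int[P0]_w (B0 v w ^+ 2)%:E <= m2%:E)%E.
Local Open Scope ereal_scope.

Let b v := fine (\int[P0]_w `|B0 v w|%:E).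
Let m v := fine (\int[P0]_w (B0 v w ^+ 2)%:E).
Let Xa v := compound_sum (N v) (fun j w => `|B v j w|%R).
Let x v := (b v * lambda v)%R.

Let int_abs0 v : 0 <= \int[P0]_w `|B0 v w|%:E.
Proof. by apply: integral_ge0 => w _; rewrite lee_fin. Qed.
Let int_sqr0 v : 0 <= \int[P0]_w (B0 v w ^+ 2)%:E.
Proof. by apply: integral_ge0 => w _; rewrite lee_fin sqr_ge0. Qed.
Let bE v : \int[P0]_w `|B0 v w|%:E = (b v)%:E.
Proof.
rewrite fineK// ge0_fin_numE//.
exact: le_lt_trans (mean_le v) (ltry _).
Qed.
Let mE v : \int[P0]_w (B0 v w ^+ 2)%:E = (m v)%:E.
Proof.
rewrite fineK// ge0_fin_numE//.
exact: le_lt_trans (sqr_le v) (ltry _).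
Qed.
Let b0 v : (0 <= b v)%R. Proof. by rewrite -lee_fin -bE. Qed.
Let b_le v : (b v <= beta)%R. Proof. by rewrite -lee_fin -bE. Qed.
Let m_ge0 v : (0 <= m v)%R. Proof. by rewrite -lee_fin -mE. Qed.
Let m_le v : (m v <= m2)%R. Proof. by rewrite -lee_fin -mE. Qed.
Let l0 v : (0 < lambda v)%R. Proof. by case: adm. Qed.

Let finW : finite_set W. Proof. exact: finite_ball_vertices bethe _. Qed.
Let sW v : (v \in s) = (v \in W). Proof. by rewrite in_fset_set. Qed.

Let N_moments :
  (forall u, W u -> \int[P]_w ((N u w)%:R : R)%:E = (lambda u)%:E) /\
  (forall u, W u -> \int[P]_w ((N u w)%:R * (N u w)%:R : R)%:E <=
     (lambda u * lambda u + lambda u)%:E) /\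
  (forall u v, W u -> W v -> exists k, walk E u v k /\
    \int[P]_w ((N u w)%:R * (N v w)%:R)%:E <=
    (lambda u * lambda v + Num.sqrt (lambda u * lambda v) * abar ^+ k)%:E).
Proof.
have symE : symmetric E by case: bethe => -[].
case: adm => _ _ amin.
have [||||||mean [sqr mixed]] := MPMRF_moments (abar := abar) N_law.
- by move=> u v; rewrite /induced_edges /= symE andbCA.
- by move=> u v /and3P[/set_mem].
- by move=> u v Wu Wv; exact: (walk_induced2 bethe Wu Wv).
- by [].
- by move=> u v /and3P[_ _ /amin].
- by move=> u v /and3P[_ _ /alpha_le].
split=> //; split=> // u v Wu Wv; have [k [[p [Ep lp sp]] le]] := mixed u v Wu Wv.
(* The walk found in the induced subgraph is regarded as a walk of the whole lattice, where every
   vertex has exactly [chi] neighbours, as the counting of walks requires. *)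
exists k; split=> //; exists p; split=> //.
by apply: sub_path Ep => y z /and3P[].
Qed.

Let mX v : measurable_fun setT (X v).
Proof. exact: measurable_compound_sum. Qed.
Let mXa v : measurable_fun setT (Xa v).
Proof. by apply: measurable_compound_sum => // j; exact: measurableT_comp. Qed.
Let Xa0 v w : (0 <= Xa v w)%R. Proof. by apply: sumr_ge0. Qed.

Let Xa_mean v : W v -> \int[P]_w (Xa v w)%:E = (x v)%:E.
Proof.
move=> Wv; rewrite (claim_total_mean B_law bE Wv).
by case: N_moments => -> // _; rewrite -EFinM.
Qed.

(** A single constant covers both cases: the diagonal excess [(b u * b u + m u) * lambda u], with a
    walk of length 0, and the off-diagonal covariance, which needs only
    [beta * beta * lambda_max]. *)
Let Xa_mixed u v : W u -> W v -> exists k, walk E u v k /\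
  \int[P]_w (Xa u w * Xa v w)%:E <=
  (x u * x v + (beta * beta + m2) * lambda_max * abar ^+ k)%:E.
Proof.
move=> Wu Wv; case: N_moments => mean [sqr mixed].
have beta0 : (0 <= beta)%R := le_trans (b0 u) (b_le u).
have m20 : (0 <= m2)%R := le_trans (m_ge0 u) (m_le u).
have bb : (b u * b v <= beta * beta)%R by exact: ler_pM.
have [<-|uv] := pselect (u = v).
  exists 0%N; split; first exact: walk0.
  apply: le_trans (claim_total_sqr B_law bE mE Wu) _.
  rewrite mean//.
  apply: le_trans (leeD (lee_wpmul2l _ (sqr _ Wu)) (lexx _)) _.
    by rewrite lee_fin mulr_ge0.
  rewrite -!EFinM -EFinD lee_fin expr0 mulr1.
  have -> : (b u * b u * (lambda u * lambda u + lambda u) + m u * lambda u =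
      x u * x u + (b u * b u + m u) * lambda u)%R by rewrite /x; ring.
  rewrite lerD2l ler_pM ?addr_ge0 ?mulr_ge0 ?lerD ?ler_pM//.
  exact: ltW.
have [k [wk le]] := mixed u v Wu Wv; exists k; split=> //.
rewrite (claim_total_mixed B_law bE Wu Wv uv).
apply: le_trans (lee_wpmul2l _ le) _; first by rewrite lee_fin mulr_ge0.
rewrite -EFinM lee_fin.
have -> : (b u * b v * (lambda u * lambda v +
      Num.sqrt (lambda u * lambda v) * abar ^+ k) =
    x u * x v + b u * b v * Num.sqrt (lambda u * lambda v) * abar ^+ k)%R.
  by rewrite /x; ring.
case/andP: abar01 => a0 _.
have L0 : (0 <= lambda_max)%R := le_trans (ltW (l0 u)) (lambda_le u).
rewrite lerD2l ler_wpM2r ?exprn_ge0// ler_pM ?mulr_ge0 ?sqrtr_ge0//.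
  by rewrite (le_trans bb)// lerDl.
rewrite -(ger0_norm L0) -sqrtr_sqr ler_sqrt ?sqr_ge0// expr2.
by rewrite ler_pM// ltW.
Qed.

Let ae_X v : W v -> ae_eq P setT (fun w => (X v w)%:E) (fun w => (Xa v w)%:E).
Proof.
move=> Wv; have := claim_total_abs B_law (B0_ge0 v) Wv.
by apply: filterS => w /= Xw _; rewrite /X Xw.
Qed.

Lemma bethe_claim_mean v : W v ->
  'E_P[X v] = (lambda v)%:E * 'E_P0[B0 v].
Proof.
move=> Wv; rewrite unlock.
rewrite (ae_eq_integral _ _ measurableT _ _ (ae_X Wv)); last 2 first.
- exact/measurable_EFinP.
- exact/measurable_EFinP.
rewrite Xa_mean//.
have -> : \int[P0]_w (B0 v w)%:E = \int[P0]_w `|B0 v w|%:E.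
  apply: ae_eq_integral => //; [exact/measurable_EFinP| |].
    by apply/measurable_EFinP; exact: measurableT_comp.
  by apply: filterS (B0_ge0 v) => w Bw _; rewrite ger0_norm.
by rewrite bE -EFinM mulrC.
Qed.

Lemma bethe_total_deviation k (eps : R) : (0 < eps)%R ->
  P [set w | (eps <= `|\sum_(u \in W) X u w -
                        fine ('E_P[fun w => \sum_(u \in W) X u w])|)%R] <=
  ((beta * beta + m2) * lambda_max *
     ((size s)%:R * (chi.+1 ^ k)%:R + (size s)%:R ^+ 2 * abar ^+ k) / eps ^+ 2)%:E.
Proof.
move=> eps0.
have [nbrs [nbrsP sz _]] := bethe_nbrs bethe.
pose S w := (\sum_(u <- s) X u w)%R; pose Sa w := (\sum_(u <- s) Xa u w)%R.
have SE w : (\sum_(u \in W) X u w = S w)%R by rewrite fsbig_finite.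
under eq_set do rewrite SE.
rewrite (_ : (fun w => \sum_(u \in W) X u w)%R = S); last first.
  by apply/funext => w; exact: SE.
have mS : measurable_fun setT S by exact: measurable_sum.
have mSa : measurable_fun setT Sa by exact: measurable_sum.
have Sa0 w : (0 <= Sa w)%R by exact: sumr_ge0.
have ae_S : {ae P, forall w, S w = Sa w}.
  have : {ae P, forall w, forall u, u \in s -> X u w = Xa u w}.
    have Wall u : u \in s -> {ae P, forall w, X u w = Xa u w}.
      by rewrite sW inE => Wu; exact: claim_total_abs B_law (B0_ge0 u) Wu.
    elim: (s : seq V) Wall => [|u t IH] Wall; first exact: aeW.
    have tW v : v \in t -> {ae P, forall w, X v w = Xa v w}.
      by move=> vt; apply: Wall; rewrite inE vt orbT.
    apply: filterS2 (Wall u (mem_head _ _)) (IH tW) => w Xu Xt v.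
    by rewrite inE => /predU1P[->//|/Xt].
  by apply: filterS => w Xw; apply: eq_big_seq => u /Xw.
pose mu := (\sum_(u <- s) x u)%R.
have x0 u : (0 <= x u)%R by rewrite mulr_ge0// ltW.
have Sa_mean : \int[P]_w (Sa w)%:E = mu%:E.
  under eq_integral do rewrite -sumEFin.
  rewrite ge0_integral_sum//; last 2 first.
  - by move=> u; exact/measurable_EFinP.
  - by move=> u w _; rewrite lee_fin.
  rewrite -sumEFin; apply: eq_big_seq => u; rewrite sW inE => Wu.
  exact: Xa_mean.
have S_mean : 'E_P[S] = mu%:E.
  rewrite unlock -Sa_mean; apply: ae_eq_integral => //.
  - exact/measurable_EFinP.
  - exact/measurable_EFinP.
  - by apply: filterS ae_S => w Sw _; rewrite Sw.
rewrite S_mean /=.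
have -> : P [set w | (eps <= `|S w - mu|)%R] = P [set w | (eps <= `|Sa w - mu|)%R].
  have [i1 i2] := (integral_indic P measurableT (measurable_deviation mu eps mS),
                   integral_indic P measurableT (measurable_deviation mu eps mSa)).
  rewrite setIT in i1; rewrite setIT in i2; rewrite -i1 -i2.
  apply: ae_eq_integral => //.
  - by apply/measurable_EFinP/measurable_indic/measurable_deviation.
  - by apply/measurable_EFinP/measurable_indic/measurable_deviation.
  - by apply: filterS ae_S => w Sw _; rewrite !indicE;
    congr ((nat_of_bool _)%:R)%:E; apply/idP/idP; rewrite !inE /= Sw.
have C0 : (0 <= (beta * beta + m2) * lambda_max)%R.
  rewrite mulr_ge0//; last exact: le_trans (ltW (l0 r)) (lambda_le r).
  rewrite addr_ge0 ?mulr_ge0 ?(le_trans (b0 r) (b_le r))//.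
  exact: le_trans (m_ge0 r) (m_le r).
have [f fP] : exists f : V -> V -> nat, forall u v, u \in s -> v \in s ->
    walk E u v (f u v) /\ \int[P]_w (Xa u w * Xa v w)%:E <=
      (x u * x v + (beta * beta + m2) * lambda_max * abar ^+ (f u v))%:E.
  have ex u v : exists k, u \in s -> v \in s -> walk E u v k /\
      \int[P]_w (Xa u w * Xa v w)%:E <=
      (x u * x v + (beta * beta + m2) * lambda_max * abar ^+ k)%:E.
    have [/andP[us vs]|no] := boolP ((u \in s) && (v \in s)); last first.
      by exists 0%N => us vs; rewrite us vs in no.
    rewrite sW inE in us; rewrite sW inE in vs.
    by have [k' kP] := Xa_mixed us vs; exists k'.
  have [f fP] := choice (fun uv : V * V => ex uv.1 uv.2).
  by exists (fun u v => f (u, v)) => u v; exact: (fP (u, v)).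
apply: deviation_bound => //; first exact: sumr_ge0.
apply: le_trans (second_moment_sum (x := x) (r := fun u v =>
  (beta * beta + m2) * lambda_max * abar ^+ (f u v))%R _ Xa0 _) _ => //.
  by move=> u v us vs; have [] := fP u v us vs.
rewrite lee_fin lerD2l.
under eq_bigr do rewrite -mulr_sumr.
rewrite -mulr_sumr ler_wpM2l//.
apply: (sum_geometric_walks (nbrs := nbrs) (E := E)) => //.
  exact: fset_uniq.
by move=> u v us vs; have [] := fP u v us vs.
Qed.

End bethe_total.

(** * Uniform bounds and the passage to the limit *)

Lemma ereal_sup_lt_bound (R : realType) (I : Type) (D : set I) (f : I -> \bar R)
    (c : R) : (0 < c)%R -> (ereal_sup [set f i | i in D] < c%:E)%E ->
  exists M : R, 0 <= M < c /\ forall i, D i -> (f i <= M%:E)%E.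
Proof.
move=> c0; have ub i : D i -> (f i <= ereal_sup [set f i | i in D])%E.
  by move=> Di; apply: ereal_sup_ubound; exists i.
case: (ereal_sup _) ub => [s||] ub sc.
(* The maximum with 0 makes the bound usable as the base [abar] of decreasing powers. *)
- exists (Num.max 0 s); rewrite lte_fin in sc; split.
    by rewrite le_max lexx gt_max c0.
  by move=> i /ub /le_trans; apply; rewrite lee_fin le_max lexx orbT.
- by [].
- exists 0; rewrite lexx; split=> // i /ub; rewrite leeNy_eq => /eqP ->.
  exact: leNye.
Qed.

Lemma ereal_sup_lty_bound (R : realType) (I : Type) (D : set I) (f : I -> \bar R) :
  (ereal_sup [set f i | i in D] < +oo)%E ->
  exists M : R, 0 <= M /\ forall i, D i -> (f i <= M%:E)%E.
Proof.
move=> supy; have [c c0 sc] : exists2 c : R, 0 < c &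
    (ereal_sup [set f i | i in D] < c%:E)%E.
  case: (ereal_sup _) supy => [s||] // _; last by exists 1 => //; exact: ltNyr.
  by exists (`|s| + 1); rewrite ?ltr_wpDl// lte_fin (le_lt_trans (ler_norm s))// ltrDl.
have [M [/andP[M0 _] MP]] := ereal_sup_lt_bound c0 sc.
by exists M.
Qed.

Lemma cvg_ge0_eventually_le (R : realType) (u : nat -> \bar R) :
  (forall n, 0 <= u n)%E ->
  (forall delta : R, 0 < delta -> \forall n \near \oo, (u n <= delta%:E)%E) ->
  u n @[n --> \oo] --> 0%E.
Proof.
move=> u0 ule; apply/fine_cvgP; split.
  near=> n; rewrite ge0_fin_numE//.
  apply: (@le_lt_trans _ _ 1%:E); last exact: ltry.
  by near: n; exact: ule.
apply/cvgrPdist_le => delta delta0; near=> n.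
have un : (u n <= delta%:E)%E by near: n; exact: ule.
rewrite sub0r normrN /= ger0_norm ?fine_ge0//.
rewrite -lee_fin fineK// ge0_fin_numE//.
exact: le_lt_trans un (ltry _).
Unshelve. all: by end_near. Qed.

Lemma deviation_vanishes (R : realType) (C K eps abar delta : R) (chi : nat)
    (card : nat -> nat) :
  0 <= C -> 0 < K -> 0 < eps -> 0 <= abar < 1 -> 0 < delta ->
  (forall n, n < card n)%N ->
  exists k, \forall n \near \oo, forall a : R,
    `|a| <= K * (card n)%:R^-1 -> a != 0 ->
    C * ((card n)%:R * (chi.+1 ^ k)%:R + (card n)%:R ^+ 2 * abar ^+ k) /
      (eps / `|a|) ^+ 2 <= delta.
Proof.
move=> C0 K0 eps0 /andP[abar0 abar1] delta0 card_gt.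
(* With [x] the size of the ball and [c] the factor [chi.+1 ^ k], the whole bound is at most
   [D * c / x + D * abar ^+ k]. Each term is brought below [delta / 2]: the second by [k], the first
   by [n]. As [D] may vanish, [k] is chosen with [D + 1] in the denominator. *)
pose D := C * K ^+ 2 / eps ^+ 2.
have D0 : 0 <= D.
  by apply: divr_ge0; [apply: mulr_ge0 => //|]; exact: sqr_ge0.
have D1 : 0 < 2 * (D + 1) by lra.
have [k ak] : exists k, abar ^+ k <= delta / (2 * (D + 1)).
  have : (abar ^+ n)%R @[n --> \oo] --> (0 : R).
    by apply: cvg_expr; rewrite ger0_norm.
  move=> /cvgrPdist_le /(_ (delta / (2 * (D + 1)))).
  rewrite divr_gt0// => /(_ isT)[k _ /(_ k (leqnn k)) /=].
  by rewrite sub0r normrN ger0_norm ?exprn_ge0// => ak; exists k.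
exists k; pose c := (chi.+1 ^ k)%:R : R.
have c0 : 0 <= c by [].
near=> n => a aK a0.
have card0 : 0 < (card n)%:R :> R by rewrite ltr0n (leq_trans _ (card_gt n)).
have cardn : 2 * D * c / delta <= (card n)%:R.
  apply: (@le_trans _ _ n%:R); last by rewrite ler_nat ltnW.
  near: n; exact: nbhs_infty_ger.
set x := (card n)%:R in aK card0 cardn *.
have na0 : 0 < `|a| by rewrite normr_gt0.
have -> : C * (x * c + x ^+ 2 * abar ^+ k) / (eps / `|a|) ^+ 2 =
    C * (x * c + x ^+ 2 * abar ^+ k) / eps ^+ 2 * `|a| ^+ 2.
  by field; rewrite !gt_eqF.
have T0 : 0 <= C * (x * c + x ^+ 2 * abar ^+ k) / eps ^+ 2.
  rewrite divr_ge0 ?sqr_ge0// mulr_ge0// addr_ge0// mulr_ge0 ?exprn_ge0//;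
  exact: ltW.
have a2 : `|a| ^+ 2 <= (K / x) ^+ 2.
  by rewrite ler_sqr ?nnegrE ?divr_ge0// ltW.
apply: le_trans (ler_wpM2l T0 a2) _.
have -> : C * (x * c + x ^+ 2 * abar ^+ k) / eps ^+ 2 * (K / x) ^+ 2 =
    D * c / x + D * abar ^+ k.
  by rewrite /D; field; rewrite !gt_eqF.
have h1 : D * c / x <= delta / 2.
  rewrite ler_pdivrMr//; move: cardn; rewrite ler_pdivrMr// => cardn.
  lra.
have h2 : D * abar ^+ k <= delta / 2.
  apply: le_trans (ler_wpM2l D0 ak) _.
  rewrite mulrA ler_pdivrMr//; nra.
lra.
Unshelve. all: by end_near. Qed.

(** Pointwise, [|x|] is at most [1 + x ^+ 2]. This is where the bound [1 + m2] on the mean claims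
    comes from. *)
Lemma expectation_norm_le_sqr d (T : measurableType d) (R : realType)
    (P : probability T R) (X : {RV P >-> R}) :
  (\int[P]_w `|X w|%:E <= 1 + \int[P]_w (X w ^+ 2)%:E)%E.
Proof.
have mX2 : measurable_fun setT (fun w => (X w ^+ 2)%:E).
  by apply/measurable_EFinP; exact: measurable_funX.
have X20 w : (0 <= (X w ^+ 2)%:E)%E by rewrite lee_fin sqr_ge0.
rewrite -[in leRHS](integral_probability_cst P 1) -ge0_integralD//.
apply: ge0_le_integral => //.
- by apply/measurable_EFinP; exact: measurableT_comp.
- by apply: emeasurable_funD.
move=> w _; rewrite -EFinD lee_fin.
by have [x0|x0] := leP 0 (X w); [rewrite ger0_norm//|rewrite ltr0_norm//]; nra.
Qed.

Unset Implicit Arguments.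

Theorem theorem4p7 (R : realType) (chi : nat) (chi_ge2 : (2 <= chi)%N)
  (V : choiceType) (E : rel V) (bethe : bethe_lattice E chi) (r : V)
  (lambda : V -> R) (alpha : V -> V -> R)
  (adm : admissible E lambda alpha)
  (sup_lambda : (ereal_sup [set (lambda v)%:E | v in [set: V]] < +oo)%E)
  (sup_alpha :
    (ereal_sup [set (alpha e.1 e.2)%:E | e in [set e : V * V | E e.1 e.2]]
       < 1)%E)
  (d0 : measure_display) (T0 : measurableType d0) (P0 : probability T0 R)
  (B0 : V -> {RV P0 >-> R})
  (B0_ge0 : forall v, {ae P0, forall w, 0 <= B0 v w})
  (sup_B0 : (ereal_sup [set 'E_P0[fun w => (B0 v w ^+ 2)%R] | v in [set: V]]
               < +oo)%E)
  (d : nat -> measure_display) (T : forall xi, measurableType (d xi))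
  (P : forall xi, probability (T xi) R)
  (N : forall xi, V -> {RV (P xi) >-> nat})
  (N_law : forall xi,
    MPMRF (ball_vertices E r xi) (induced_edges E (ball_vertices E r xi))
      lambda alpha (N xi))
  (B : forall xi, V -> nat -> {RV (P xi) >-> R})
  (B_law : forall xi, claim_amounts (ball_vertices E r xi) B0 (N xi) (B xi))
  (a : nat -> V -> R)
  (sum_a : forall xi, \sum_(v \in ball_vertices E r xi) a xi v = 1) :
  let X := fun xi v => compound_sum (N xi v) (B xi v) in
  let size_ball := fun xi => #|` fset_set (ball_vertices E r xi) | in
  forall v : V,
    (forall xi, ball_vertices E r xi v ->
       ('E_(P xi)[X xi v] = (lambda v)%:E * 'E_P0[B0 v])%E) /\
    ((fun xi => a xi v) =O_\oo (fun xi => (size_ball xi)%:R^-1 : R) ->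
     forall xi0, ball_vertices E r xi0 v ->
       cvg_in_probability P
         (fun xi => linear_rule (ball_vertices E r xi) (P xi) (X xi) (a xi) v)
         (fine ('E_(P xi0)[X xi0 v])%E)).
Proof.
move=> X size_ball v.
have [lmax [lmax0 lP]] := ereal_sup_lty_bound sup_lambda.
have [abar [abar01 aP]] := ereal_sup_lt_bound ltr01 sup_alpha.
have [m2 [m20 m2P]] := ereal_sup_lty_bound sup_B0.
have lambda_le u : lambda u <= lmax by rewrite -lee_fin; exact: lP.
have alpha_le u w : E u w -> alpha u w <= abar.
  by move=> uw; rewrite -lee_fin; exact: (aP (u, w)).
have sqr_le u : (\int[P0]_w (B0 u w ^+ 2)%:E <= m2%:E)%E.
  by have := m2P u I; rewrite unlock.
have mean_le u : (\int[P0]_w `|B0 u w|%:E <= (1 + m2)%:E)%E.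
  by rewrite EFinD (le_trans (expectation_norm_le_sqr _))// leeD2l.
have abar1 : 0 <= abar <= 1 by case/andP: abar01 => -> /ltW.
have mean xi u : ball_vertices E r xi u ->
    ('E_(P xi)[X xi u] = (lambda u)%:E * 'E_P0[B0 u])%E.
  move=> ru; exact: (bethe_claim_mean bethe adm (N_law xi) (B_law xi) B0_ge0
    alpha_le mean_le ru).
split; first by move=> xi; exact: mean.
move=> /eqO_exP[K /= K0 aK] xi0 rv0 eps eps0.
apply: cvg_ge0_eventually_le => // delta delta0.
have C0 : 0 <= ((1 + m2) * (1 + m2) + m2) * lmax.
  by rewrite mulr_ge0// addr_ge0// mulr_ge0// addr_ge0.
have [k kP] := deviation_vanishes chi C0 K0 eps0 abar01 delta0
  (fun n => card_ball_vertices r bethe n chi_ge2).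
have rvN : \forall n \near \oo, ball_vertices E r n v.
  by exists xi0 => // n /=; exact: leq_trans rv0.
apply: filterS3 rvN aK kP => n rvn an kPn.
rewrite [X in _ * X]ger0_norm ?invr_ge0// in an.
(* The limit is stated with the mean at radius [xi0]; the formula for the mean, free of the radius,
   moves it to radius [n]. *)
rewrite mean// -(mean _ _ rvn).
(* A zero coefficient makes the rule constant, so the event is empty. Otherwise the event says that
   the total deviates from its mean by at least [eps / |a n v|]. *)
have [a0|a0] := eqVneq (a n v) 0.
  rewrite (_ : [set w | _] = set0) ?measure0 ?lee_fin ?ltW//.
  apply/seteqP; split=> // w /=.
  by rewrite /linear_rule a0 mul0r addr0 subrr normr0 leNgt eps0.
rewrite (_ : [set w | _] = [set w | eps / `|a n v| <=
    `|\sum_(u \in ball_vertices E r n) X n u w -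
      fine ('E_(P n)[fun w => (\sum_(u \in ball_vertices E r n) X n u w)%R])%E|]).
  apply: le_trans (bethe_total_deviation bethe adm (N_law n) (B_law n) B0_ge0
    lambda_le alpha_le abar1 mean_le sqr_le k (divr_gt0 eps0 _)) _.
    by rewrite normr_gt0.
  by rewrite lee_fin; exact: kPn.
apply/seteqP; split=> w /=; rewrite /linear_rule [_ + _ * _]addrC addrK normrM.
  by rewrite ler_pdivrMr ?normr_gt0// mulrC.
by rewrite ler_pdivrMr ?normr_gt0// mulrC.
Qed.
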